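(* Let $\mathcal{S}$ be a numerical semigroup minimally generated by $A=\{a_1,a_2,a_3\}$ (three distinct generators). The following are equivalent: (a) $\mathcal{S}$ is universally free. (b) $\mathcal{S}$ is Betti divisible. (c) There exist positive integers $d_1,d_2,d_3$ and $f_3$ such that $A=\{d_2d_3,\ d_1d_3,\ f_3d_1d_2\}$ and $\operatorname{Betti}(A)=\{d_1d_2d_3,\ f_3d_1d_2d_3\}$; in particular, $\gcd(d_i,d_j)=1$ for $i\neq j$ and $\gcd(f_3,d_3)=1$. Moreover, in this case, up to permutation of the indeterminates (that is, labelling the generators so that $a_1=d_2d_3$, $a_2=d_1d_3$, $a_3=f_3d_1d_2$), $$\mathcal{M}_A=\{x_1^{d_1}-x_2^{d_2}\}\cup\{x_3^{d_3}-x_1^{(f_3-k)d_1}x_2^{kd_2}\mid k=0,1,\ldots,f_3\}=\operatorname{Cr}_A=\operatorname{Gr}_A,$$ and $$\mathcal{U}_A=\{x_1^{d_1}-x_2^{d_2},\ x_1^{f_3d_1}-x_3^{d_3},\ x_2^{f_3d_2}-x_3^{d_3}\}=\mathcal{C}_A.$$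
   Context: $\mathbb{K}$ is an arbitrary field and $\mathbb{N}$ contains $0$. For positive integers $a_1,\ldots,a_n$, $\langle a_1,\ldots,a_n\rangle=\{u_1a_1+\cdots+u_na_n\mid u_i\in\mathbb{N}\}$. A numerical semigroup is a submonoid of $\mathbb{N}$ generated by a finite set of positive integers with greatest common divisor $1$; its minimal generating set is its unique generating set no proper subset of which generates it. For $A=\{a_1,\ldots,a_n\}$, the $A$-degree of $\mathbf{x}^{\mathbf{u}}=x_1^{u_1}\cdots x_n^{u_n}$ is $u_1a_1+\cdots+u_na_n$, and the toric ideal of $A$ is $I_A=\langle \mathbf{x}^{\mathbf{u}}-\mathbf{x}^{\mathbf{v}}\mid \deg_A(\mathbf{x}^{\mathbf{u}})=\deg_A(\mathbf{x}^{\mathbf{v}})\rangle\subseteq\mathbb{K}[x_1,\ldots,x_n]$. In all the sets below, a binomial is identified with its opposite. - Markov basis: a generating set of $I_A$ consisting of binomials $\mathbf{x}^{\mathbf{u}}-\mathbf{x}^{\mathbf{v}}\in I_A$ that is minimal with respect to inclusion. The universal Markov basis $\mathcal{M}_A$ is the union of all Markov bases. The $A$-degrees of the elements of a Markov basis do not depend on the Markov basis; they are called the Betti degrees of $I_A$, and $\operatorname{Betti}(A)$ is the set of them. - Graver basis $\operatorname{Gr}_A$: the set of primitive binomials, where a nonzero binomial $\mathbf{x}^{\mathbf{u}}-\mathbf{x}^{\mathbf{v}}\in I_A$ is primitive if there is no other nonzero binomial $\mathbf{x}^{\mathbf{w}}-\mathbf{x}^{\mathbf{z}}\in I_A$ with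 $\mathbf{x}^{\mathbf{w}}\mid\mathbf{x}^{\mathbf{u}}$ and $\mathbf{x}^{\mathbf{z}}\mid\mathbf{x}^{\mathbf{v}}$. - Universal Gröbner basis $\mathcal{U}_A$: the union of all reduced Gröbner bases of $I_A$ over all monomial orders. - Circuits $\mathcal{C}_A$: a binomial $\mathbf{x}^{\mathbf{u}}-\mathbf{x}^{\mathbf{v}}\in I_A$ is irreducible if $\operatorname{supp}(\mathbf{u})\cap\operatorname{supp}(\mathbf{v})=\emptyset$ (with $\operatorname{supp}(\mathbf{u})=\{i\mid u_i\neq0\}$) and the nonzero entries of $\mathbf{u}+\mathbf{v}$ are relatively prime; $\mathcal{C}_A$ is the set of irreducible binomials whose support $\operatorname{supp}(\mathbf{u})\cup\operatorname{supp}(\mathbf{v})$ is inclusion-minimal among nonzero binomials of $I_A$. Equivalently, $\mathcal{C}_A=\{x_i^{a_j/\gcd(a_i,a_j)}-x_j^{a_i/\gcd(a_i,a_j)}\mid i\neq j\}$. - Critical binomials $\operatorname{Cr}_A$: let $c_i=\min\{c\in\mathbb{Z}^+\mid c\,a_i\in\langle a_j\mid j\neq i\rangle\}$; whenever $c_ia_i=\sum_{j\neq i}r_{ij}a_j$ with $r_{ij}\in\mathbb{N}$, the binomial $x_i^{c_i}-\prod_{j\neq i}x_j^{r_{ij}}$ is a critical binomial with respect to $x_i$. $\operatorname{Cr}_A$ is the set of all critical binomials, for all $i$. A numerical semigroup with minimal generating set $\{a_1,\ldots,a_n\}$ is free for the arrangement $(a_1,\ldots,a_n)$ if $\operatorname{lcm}\big(a_i,\gcd(a_{i+1},\ldots,a_n)\big)\in\langle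 a_{i+1},\ldots,a_n\rangle$ for all $i\in\{1,\ldots,n-1\}$. It is universally free if it is free for every arrangement (ordering) of its minimal generating set. It is Betti divisible if the Betti degrees of $I_A$ are (totally) ordered by divisibility. *)

(* Defs.v *)
From mathcomp Require Import all_boot all_order all_algebra.
From mathcomp Require Import mpoly.

Set Implicit Arguments.
Unset Strict Implicit.
Unset Printing Implicit Defensive.

Import GRing.Theory.
Local Open Scope ring_scope.

(* Sets of naturals and sets of polynomials are Prop-valued predicates.
   The generators a_1, ..., a_n are given as a family a : 'I_n -> nat, the
   generator a i being attached to the indeterminate 'X_i. *)

Section Semigroups.
Variable n : nat.
Implicit Types (a : 'I_n -> nat) (J : {set 'I_n}).

Definition generated a J (s : nat) : Prop :=
  exists u : 'I_n -> nat, s = (\sum_(i in J) u i * a i)%N.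

(* No proper subset of {a_1, ..., a_n} generates S; as a is injective, subsets
   of {a_1, ..., a_n} are the same as sets of indices. *)
Definition minimal_generators (S : nat -> Prop) a : Prop :=
  [/\ injective a,
      forall s, S s <-> generated a [set: 'I_n] s
    & forall J, J \proper [set: 'I_n] -> ~ (forall s, S s <-> generated a J s)].

Definition free_for a : Prop :=
  forall i : 'I_n, (i.+1 < n)%N ->
    generated a [set j : 'I_n | (i < j)%N]
      (lcmn (a i) (\big[gcdn/0%N]_(j : 'I_n | (i < j)%N) a j)).

End Semigroups.

Definition numerical_semigroup (S : nat -> Prop) : Prop :=
  exists n (b : 'I_n -> nat),
    [/\ forall i, (0 < b i)%N,
        \big[gcdn/0%N]_(i < n) b i = 1%N
      & forall s, S s <-> generated b [set: 'I_n] s].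

(* An arrangement of the minimal generating set is an injective family b
   enumerating it. *)
Definition universally_free (S : nat -> Prop) : Prop :=
  forall n (b : 'I_n -> nat), minimal_generators S b -> free_for b.

Section Toric.
Variables (K : fieldType) (n : nat).
Implicit Types (a : 'I_n -> nat) (u v w z m : 'X_{1..n}) (p q : {mpoly K[n]}).
Implicit Types (G B I : {mpoly K[n]} -> Prop).

Definition same_set G B : Prop := forall p, G p <-> B p.

(* Equality of two sets of polynomials in which p is identified with - p. *)
Definition same_set_up_to_sign G B : Prop :=
  forall p, (G p \/ G (- p)) <-> (B p \/ B (- p)).

Definition ideal_gen G : {mpoly K[n]} -> Prop := fun p =>
  exists s : seq ({mpoly K[n]} * {mpoly K[n]}),
    (forall c, c \in s -> G c.2) /\ p = \sum_(c <- s) c.1 * c.2.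

Definition binomial u v : {mpoly K[n]} := 'X_[u] - 'X_[v].

Definition adeg a u : nat := (\sum_(i < n) u i * a i)%N.

Definition toric_ideal a : {mpoly K[n]} -> Prop :=
  ideal_gen (fun p => exists u v, adeg a u = adeg a v /\ p = binomial u v).

Definition nonzero_toric a u v : Prop :=
  binomial u v <> 0 /\ toric_ideal a (binomial u v).

Definition markov_basis a B : Prop :=
  [/\ forall p, B p -> exists u v, p = binomial u v /\ toric_ideal a p,
      same_set (ideal_gen B) (toric_ideal a)
    & forall B', (forall p, B' p -> B p) ->
        same_set (ideal_gen B') (toric_ideal a) -> forall p, B p -> B' p].

Definition universal_markov a : {mpoly K[n]} -> Prop := fun p =>
  exists B, markov_basis a B /\ B p.

(* Elements of a Markov basis are nonzero, and a nonzero element of the toric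
   ideal of the form x^u - x^v satisfies adeg a u = adeg a v. *)
Definition betti a (d : nat) : Prop :=
  exists B u v, [/\ markov_basis a B, B (binomial u v) & d = adeg a u].

Definition graver a : {mpoly K[n]} -> Prop := fun p =>
  exists u v,
    [/\ p = binomial u v, nonzero_toric a u v
      & ~ (exists w z, [/\ binomial w z <> binomial u v, nonzero_toric a w z,
             (w <= u)%MM & (z <= v)%MM])].

Definition monomial_order (le : rel 'X_{1..n}) : Prop :=
  [/\ [/\ reflexive le, antisymmetric le, transitive le & total le],
      forall m, le 0%MM m
    & forall u v m, le u v -> le (u + m)%MM (v + m)%MM].

Definition leading_mon (le : rel 'X_{1..n}) p m : Prop :=
  m \in msupp p /\ (forall m', m' \in msupp p -> le m' m).

Definition initial_ideal le G : {mpoly K[n]} -> Prop :=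
  ideal_gen (fun q => exists p m, [/\ G p, leading_mon le p m & q = 'X_[m]]).

Definition groebner_basis le I (G : seq {mpoly K[n]}) : Prop :=
  (forall g, g \in G -> I g) /\
  same_set (initial_ideal le (fun g => g \in G)) (initial_ideal le I).

Definition reduced_groebner_basis le I (G : seq {mpoly K[n]}) : Prop :=
  [/\ groebner_basis le I G,
      forall g, g \in G -> exists m, leading_mon le g m /\ g@_m = 1
    & forall g h m m', g \in G -> h \in G -> h <> g ->
        leading_mon le h m -> m' \in msupp g -> ~~ (m <= m')%MM].

Definition universal_groebner a : {mpoly K[n]} -> Prop := fun p =>
  exists (le : rel 'X_{1..n}) (G : seq {mpoly K[n]}),
    [/\ monomial_order le, reduced_groebner_basis le (toric_ideal a) G
      & p \in G].

Definition supp2 u v : {set 'I_n} := [set i | (u i != 0%N) || (v i != 0%N)].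

(* Zero entries do not contribute to the gcd. *)
Definition irreducible_exponents u v : Prop :=
  (forall i, u i = 0%N \/ v i = 0%N) /\
  \big[gcdn/0%N]_(i < n) (u i + v i)%N = 1%N.

Definition circuits a : {mpoly K[n]} -> Prop := fun p =>
  exists u v,
    [/\ p = binomial u v, toric_ideal a p, irreducible_exponents u v
      & forall w z, nonzero_toric a w z -> ~~ (supp2 w z \proper supp2 u v)].

Definition critical_exponent a (i : 'I_n) (c : nat) : Prop :=
  [/\ (0 < c)%N, generated a [set~ i] (c * a i)%N
    & forall c', (0 < c')%N -> generated a [set~ i] (c' * a i)%N -> (c <= c')%N].

Definition critical a : {mpoly K[n]} -> Prop := fun p =>
  exists i c (r : 'X_{1..n}),
    [/\ critical_exponent a i c, r i = 0%N, (c * a i)%N = adeg a r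
      & p = 'X_i ^+ c - 'X_[r]].

End Toric.

Definition betti_divisible (K : fieldType) n (a : 'I_n -> nat) : Prop :=
  forall d e, betti K a d -> betti K a e -> (d %| e)%N \/ (e %| d)%N.

Definition betti_form (K : fieldType) (a : 'I_3 -> nat) (d1 d2 d3 f3 : nat) :
    Prop :=
  [/\ [/\ (0 < d1)%N, (0 < d2)%N, (0 < d3)%N & (0 < f3)%N],
      codom a =i [:: d2 * d3; d1 * d3; f3 * d1 * d2]%N
    & forall b, betti K a b <->
        b = (d1 * d2 * d3)%N \/ b = (f3 * d1 * d2 * d3)%N].

(* Main.v *)
Require Import Defs.
From mathcomp Require Import all_boot all_order all_algebra.
From mathcomp Require Import mpoly.
From mathcomp Require Import perm zify.
From Stdlib Require Import Relation_Operators Operators_Properties.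
From Stdlib Require Import ClassicalEpsilon PropExtensionality FunctionalExtensionality.

Import Defs.

(** All the sets of binomials in the statement are governed by combinatorics of
    monomials. A binomial x^u - x^v lies in the ideal generated by a set of
    binomials exactly when u and v are related by the congruence which that set
    generates ([congruent_ideal], [ideal_congruent]); for the toric ideal this
    congruence is equality of A-degrees.

    In a fixed A-degree, call two monomials linked if they are joined by a chain
    in which consecutive monomials share a variable. Cancelling shared variables
    shows that linked monomials are congruent modulo binomials of smaller degree,
    so a Markov basis joins the linkage classes of each fibre by a tree. Hence
    the universal Markov basis consists of the x^u - x^v with u and v unlinked in
    one fibre ([universal_markovP]), and the Betti degrees are the degrees in
    which such pairs exist. Two inclusions follow for all generators. The power
    x_i^c_i shares no variable with another monomial of its fibre, so critical
    binomials lie in the universal Markov basis ([critical_markov]), and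
    replacing a proper factor x^w of x^u by x^z links u with v, so the universal
    Markov basis lies in the Graver basis ([markov_graver]).

    Suppose the generators are d2 d3, d1 d3 and f3 d1 d2; since the generators
    have gcd 1, the pairs d_i, d_j and f3, d3 are coprime ([labelled]). Then d_i
    divides the exponent differences of x_i in every fibre ([adeg_mod]), which
    shows that a primitive binomial is one of those in the list
    ([primitive_markov_pair]). As the list consists of critical binomials, the
    list and the critical, Markov and Graver sets coincide ([markov_sets]), and
    the Betti degrees are d1 d2 d3 and f3 d1 d2 d3. For a monomial order with
    x2^d2 below x1^d1, the initial ideal is generated by x1^d1 and the larger of
    x3^d3 and x2^(f3 d2). Indeed no fibre has two monomials outside that ideal,
    and a polynomial of the toric ideal whose leading monomial were outside it
    would have a single monomial in some A-degree ([toric_leading_mon]). So the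
    elements of reduced Groebner bases are the three listed circuits, and
    lexicographic orders realise all of them.

    For the equivalence, the degrees c_i a_i of the critical binomials are Betti
    degrees. If they form a chain under divisibility, the last, say c3 a3, is a
    common multiple of all generators. By minimality c3 = a1 / gcd(a1, a3) =
    a2 / gcd(a2, a3), and the generators have the required shape
    ([critical_common_multiple]). If instead the semigroup is universally free,
    then lcm(a_i, gcd(a_j, a_k)) lies in the semigroup of a_j and a_k for each i.
    Writing a_i = d_j d_k f_i with d_i = gcd(a_j, a_k), this puts each f_i in the
    semigroup of the other two, and pairwise coprime integers with this property
    include two that are 1 ([mutually_generated]). The converses are direct
    computations. *)

Set Implicit Arguments.
Unset Strict Implicit.
Unset Printing Implicit Defensive.

Import GRing.Theory.
Local Open Scope ring_scope.

(** * Binomial ideals and congruences on monomials *)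

Section BinomialIdeals.
Variables (K : fieldType) (n : nat).
Implicit Types (u v w z m : 'X_{1..n}) (p q : {mpoly K[n]}).
Implicit Types (G B : {mpoly K[n]} -> Prop) (C : pred 'X_{1..n}).

Lemma ideal_gen_sub G p : G p -> ideal_gen G p.
Proof.
move=> Gp; exists [:: (1, p)]; split=> [c|]; last by rewrite big_seq1 mul1r.
by rewrite inE => /eqP ->.
Qed.

Lemma ideal_gen0 G : ideal_gen G 0.
Proof. by exists [::]; split=> //; rewrite big_nil. Qed.

Lemma ideal_genD G p q : ideal_gen G p -> ideal_gen G q -> ideal_gen G (p + q).
Proof.
move=> [s [Gs ->]] [t [Gt ->]]; exists (s ++ t); split; last by rewrite big_cat.
by move=> c; rewrite mem_cat => /orP[/Gs | /Gt].
Qed.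

Lemma ideal_genM G p q : ideal_gen G q -> ideal_gen G (p * q).
Proof.
move=> [s [Gs ->]]; exists [seq (p * c.1, c.2) | c <- s]; split.
  by move=> _ /mapP[c /Gs Gc ->].
by rewrite big_map mulr_sumr; apply: eq_bigr => c _; rewrite mulrA.
Qed.

Lemma ideal_genN G p : ideal_gen G p -> ideal_gen G (- p).
Proof. by rewrite -mulN1r; apply: ideal_genM. Qed.

Lemma ideal_genB G p q : ideal_gen G p -> ideal_gen G q -> ideal_gen G (p - q).
Proof. by move=> Gp /ideal_genN; apply: ideal_genD. Qed.

Lemma ideal_gen_trans G B p :
  (forall q, G q -> ideal_gen B q) -> ideal_gen G p -> ideal_gen B p.
Proof.
move=> GB [s [Gs ->]]; rewrite big_seq.
elim/big_ind: _ => [|q r|c /Gs/GB/ideal_genM]; last exact.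
  exact: ideal_gen0.
exact: ideal_genD.
Qed.

Lemma binomial_eq0 u v : (binomial K u v == 0) = (u == v).
Proof.
apply/eqP/eqP => [/mpolyP/(_ u)|->]; last exact: subrr.
rewrite mcoeff0 mcoeffB !mcoeffX eqxx eq_sym.
by case: eqVneq => // _ /eqP; rewrite subr0 oner_eq0.
Qed.

Lemma binomialN u v : - binomial K u v = binomial K v u.
Proof. by rewrite /binomial opprB. Qed.

(** Up to its sign a nonzero binomial determines its two monomials; in
    characteristic 2 the order of the two monomials is lost. *)
Lemma binomial_inj u v w z : u <> v -> binomial K w z = binomial K u v ->
  (w = u /\ z = v) \/ (w = v /\ z = u).
Proof.
move=> /eqP uv eqb; have o1 : (1 : K) != 0 := oner_neq0 _.
case: (eqVneq w u) => [wu|wu].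
  left; split=> //; move/eqP: eqb; rewrite /binomial wu -subr_eq0.
  rewrite opprB addrC addrA subrK -/(binomial K v z) binomial_eq0.
  by move=> /eqP.
have /mpolyP E := eqb; move: (E u) (E v).
rewrite !mcoeffB !mcoeffX !eqxx (negPf wu) (negPf uv) [v == u]eq_sym (negPf uv).
case: (eqVneq z u) => [-> _|_ /eqP]; last by rewrite !subr0 eq_sym (negPf o1).
case: (eqVneq w v) => [-> _|_ /eqP]; first by right.
by rewrite (negPf uv) subrr sub0r eq_sym oppr_eq0 (negPf o1).
Qed.

(** As C ranges over the unions of classes of the congruence that the binomials
    generate, these linear forms vanish on their ideal. *)
Definition coef_sum C p : K := \sum_(m <- msupp p | C m) p@_m.

Lemma coef_sum_superset C (s : seq 'X_{1..n}) p :
    uniq s -> {subset msupp p <= s} -> coef_sum C p = \sum_(m <- s | C m) p@_m.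
Proof.
move=> us sub; rewrite [RHS](bigID (mem (msupp p))) /= [X in _ + X]big1 ?addr0.
  under [RHS]eq_bigl => m do rewrite andbC.
  rewrite -[RHS]big_filter_cond; apply: perm_big; rewrite perm_sym.
  apply: uniq_perm; rewrite ?filter_uniq // => m.
  by rewrite mem_filter andb_idr => [//|/sub].
by move=> m /andP[_ /memN_msupp_eq0].
Qed.

Lemma coef_sumD C p q : coef_sum C (p + q) = coef_sum C p + coef_sum C q.
Proof.
pose s := undup (msupp p ++ msupp q ++ msupp (p + q)).
have us : uniq s by exact: undup_uniq.
have in_s m : m \in s = [|| m \in msupp p, m \in msupp q | m \in msupp (p + q)].
  by rewrite mem_undup !mem_cat.
rewrite (@coef_sum_superset C s (p + q) us); last first.
  by move=> m; rewrite in_s => ->; rewrite !orbT.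
rewrite (@coef_sum_superset C s p us); last by move=> m; rewrite in_s => ->.
rewrite (@coef_sum_superset C s q us); last first.
  by move=> m; rewrite in_s => ->; rewrite orbT.
by rewrite -big_split; apply: eq_bigr => m _; rewrite mcoeffD.
Qed.

Lemma coef_sumZX C c m : coef_sum C (c *: 'X_[m]) = c * (C m)%:R.
Proof.
rewrite (@coef_sum_superset C [:: m]) // => [|k].
  by rewrite big_mkcond big_seq1; case: (C m); rewrite ?mcoeffZ ?mcoeffX ?eqxx ?mulr0.
rewrite mcoeff_msupp mcoeffZ mcoeffX inE.
by case: (eqVneq m k) => // _; rewrite mulr0 eqxx.
Qed.

Lemma coef_sumN C p : coef_sum C (- p) = - coef_sum C p.
Proof.
apply/eqP; rewrite -addr_eq0 -coef_sumD addNr.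
by rewrite /coef_sum msupp0 big_nil.
Qed.

(** A set of monomials is a union of classes of the congruence generated by
    the binomials in G. *)
Definition saturated G C :=
  forall w z m, G (binomial K w z) -> C (w + m)%MM = C (z + m)%MM.

Definition binomials G := forall p, G p -> exists u v, p = binomial K u v.

(** A multiple of x^w - x^z is a combination of the x^(w+m) - x^(z+m), each of
    which has both or none of its monomials in a saturated set. *)
Lemma coef_sum_ideal G C p :
  binomials G -> saturated G C -> ideal_gen G p -> coef_sum C p = 0.
Proof.
move=> Gbin satC [s [Gs ->]]; rewrite big_seq.
have add0 q r : coef_sum C q = 0 -> coef_sum C r = 0 -> coef_sum C (q + r) = 0.
  by move=> q0 r0; rewrite coef_sumD q0 r0 addr0.
have c0 : coef_sum C 0 = 0 by rewrite /coef_sum msupp0 big_nil.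
elim/big_ind: _ => // c /Gs Gc; have [w [z cE]] := Gbin _ Gc.
rewrite [c.1]mpolyE mulr_suml; elim/big_ind: _ => // m _.
rewrite cE /binomial -scalerAl mulrBr -!mpolyXD scalerBr coef_sumD coef_sumN.
rewrite !coef_sumZX ![(m + _)%MM]addmC (satC w z) ?subrr //.
by rewrite cE in Gc.
Qed.

(** The congruence of the monoid of monomials generated by G: membership of a
    binomial in the ideal is a question about this relation alone. *)
Definition move_step G u v :=
  exists w z m, [/\ G (binomial K w z), u = (w + m)%MM & v = (z + m)%MM].

Definition congruent G := clos_refl_sym_trans _ (move_step G).

Lemma congruent_ideal G u v :
  congruent G u v -> ideal_gen G (binomial K u v).
Proof.
elim=> {u v} [_ _ [w [z [m [Gwz -> ->]]]]|u|u v _|u v w _ uv _ vw].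
- rewrite /binomial !mpolyXD -mulrBl mulrC.
  by apply: ideal_genM; apply: ideal_gen_sub.
- by rewrite /binomial subrr; apply: ideal_gen0.
- by move=> /ideal_genN; rewrite binomialN.
- by have:= ideal_genD uv vw; rewrite /binomial addrA subrK.
Qed.

Definition asbool (P : Prop) : bool := excluded_middle_informative P.

Lemma asboolP P : reflect P (asbool P).
Proof. by rewrite /asbool; case: excluded_middle_informative => h; constructor. Qed.

Lemma coef_sum_binomial C u v :
  coef_sum C (binomial K u v) = (C u)%:R - (C v)%:R.
Proof.
by rewrite /binomial -[_ u]scale1r -[_ v]scale1r coef_sumD coef_sumN !coef_sumZX !mul1r.
Qed.

(** The class of u is saturated, and the coefficient sum of x^u - x^v over it is
    1 unless it contains v. *)
Lemma ideal_congruent G u v :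
  binomials G -> ideal_gen G (binomial K u v) -> congruent G u v.
Proof.
move=> Gbin Guv; pose C w := asbool (congruent G u w).
have satC : saturated G C.
  move=> w z m Gwz; have wz : congruent G (w + m)%MM (z + m)%MM.
    by apply/rst_step; exists w, z, m.
  apply/asboolP/asboolP => uw; first exact: rst_trans uw wz.
  by apply: rst_trans uw _; exact: rst_sym.
have := coef_sum_ideal Gbin satC Guv; rewrite coef_sum_binomial.
have -> : C u by apply/asboolP; apply: rst_refl.
by rewrite /C; case: asboolP => // _ /eqP; rewrite subr0 oner_eq0.
Qed.

End BinomialIdeals.

Section ToricIdeals.
Variables (K : fieldType) (n : nat) (a : 'I_n -> nat).
Implicit Types (u v w z m : 'X_{1..n}) (p q : {mpoly K[n]}).

Lemma adegD u v : adeg a (u + v)%MM = (adeg a u + adeg a v)%N.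
Proof.
by rewrite -big_split; apply: eq_bigr => i _ /=; rewrite mnmDE mulnDl.
Qed.

Lemma adeg1 i : adeg a U_(i)%MM = a i.
Proof.
rewrite /adeg (bigD1 i) //= mnm1E eqxx mul1n big1 ?addn0 // => j /negPf ji.
by rewrite mnm1E eq_sym ji.
Qed.

(** The monomials of a given A-degree are saturated for the binomials that
    define the toric ideal. *)
Lemma toric_coef_sum p d :
  toric_ideal a p -> coef_sum (fun m => adeg a m == d) p = 0.
Proof.
apply: coef_sum_ideal => [q [u [v [_ ->]]]|w z m [u [v [uv E]]]].
  by exists u, v.
suff -> : adeg a (w + m)%MM = adeg a (z + m)%MM by [].
rewrite !adegD; congr addn; case: (eqVneq u v) E => [-> /eqP|/eqP uv' /binomial_inj].
  by rewrite [X in _ == X]subrr binomial_eq0 => /eqP ->.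
by move=> /(_ uv') [] [-> ->].
Qed.

Lemma toric_binomialP u v :
  toric_ideal a (binomial K u v) <-> adeg a u = adeg a v.
Proof.
split=> [/(@toric_coef_sum _ (adeg a v))|uv].
  rewrite coef_sum_binomial eqxx; case: eqP => // _ /eqP.
  by rewrite sub0r oppr_eq0 oner_eq0.
by apply: ideal_gen_sub; exists u, v.
Qed.

Lemma nonzero_toricP u v :
  nonzero_toric K a u v <-> u <> v /\ adeg a u = adeg a v.
Proof.
have nz : binomial K u v <> 0 <-> u <> v.
  by split=> + uv; apply; apply/eqP; move/eqP: uv; rewrite binomial_eq0.
by rewrite /nonzero_toric toric_binomialP nz.
Qed.

Definition toric_binomials (B : {mpoly K[n]} -> Prop) :=
  forall p, B p -> exists u v, p = binomial K u v /\ toric_ideal a p.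

Lemma toric_generatedP B : toric_binomials B ->
  same_set (ideal_gen B) (toric_ideal a) <->
  (forall u v, adeg a u = adeg a v -> congruent B u v).
Proof.
move=> Btor; have Bbin : binomials B.
  by move=> p /Btor[u [v [-> _]]]; exists u, v.
split=> [Bgen u v /toric_binomialP/Bgen|Bcong p]; first exact: ideal_congruent.
split; apply: ideal_gen_trans => q.
  by move=> /Btor[u [v []]].
by move=> [u [v [/Bcong/congruent_ideal uv ->]]].
Qed.

End ToricIdeals.

(** * Markov bases and connectivity of fibres *)

Section Markov.
Variables (K : fieldType) (n : nat) (a : 'I_n -> nat).
Hypothesis a_gt0 : forall i, (0 < a i)%N.
Implicit Types (u v w z m : 'X_{1..n}) (p q : {mpoly K[n]}).
Implicit Types (B : {mpoly K[n]} -> Prop).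

Lemma adeg_eq0 u : adeg a u = 0%N -> u = 0%MM.
Proof.
move=> /eqP; rewrite sum_nat_eq0 => /forallP u0.
by apply/mnmP => i; move: (u0 i) (a_gt0 i); rewrite mnm0E; nia.
Qed.

Definition share u v :=
  adeg a u = adeg a v /\ exists i, (0 < u i)%N /\ (0 < v i)%N.

(** As [linked_congruent] indicates, the binomials of A-degree d with linked
    monomials are those generated by binomials of smaller degree; the connected
    components of a fibre are what a Markov basis has to join. *)
Definition linked := clos_refl_trans _ share.

Lemma share_linked u v : share u v -> linked u v.
Proof. exact: rt_step. Qed.

Lemma linked_trans u v w : linked u v -> linked v w -> linked u w.
Proof. exact: rt_trans. Qed.

Lemma linked_sym u v : linked u v -> linked v u.
Proof.
elim=> {u v} [u v [uv [i [ui vi]]]|u|u v w _ vu _ wv].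
- by apply: rt_step; split=> //; exists i.
- exact: rt_refl.
- exact: rt_trans wv vu.
Qed.

Lemma linked_adeg u v : linked u v -> adeg a u = adeg a v.
Proof. by elim=> [? ? []|//|? ? ? _ -> _ ->]. Qed.

Lemma linked_isolated u v :
  (forall w, share u w -> w = u) -> linked u v -> v = u.
Proof.
move=> iso uv; elim: uv iso => {u v} [u v uv iso|//|u v w _ IHu _ IHv iso].
  exact: iso.
by have vu := IHu iso; rewrite vu in IHv *; apply: IHv.
Qed.

Lemma congruent_adeg B u v :
  toric_binomials a B -> congruent B u v -> adeg a u = adeg a v.
Proof.
move=> Btor; elim=> {u v} [_ _ [w [z [m [/Btor[w' [z' [_ wz]]] -> ->]]]]||//|].
- by rewrite !adegD; move/toric_binomialP: wz => ->.
- by [].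
- by move=> u v w _ -> _ ->.
Qed.

Lemma congruentD B u v m :
  congruent B u v -> congruent B (u + m)%MM (v + m)%MM.
Proof.
elim=> {u v} [_ _ [w [z [k [Bwz -> ->]]]]|u|u v _|u v w _ uv _ vw].
- by apply: rst_step; exists w, z, (k + m)%MM; rewrite !addmA.
- exact: rst_refl.
- exact: rst_sym.
- exact: rst_trans uv vw.
Qed.

(** Cancelling a common variable lowers the degree, which is positive on every
    variable. *)
Lemma linked_congruent B u v :
    (forall x y, (adeg a x < adeg a u)%N -> adeg a x = adeg a y -> congruent B x y) ->
  linked u v -> congruent B u v.
Proof.
move=> low uv; elim: uv low => {u v} [u v [uv [i [ui vi]]]|u|u v w uv IHu _ IHv] low.
- have uE : (u - U_(i) + U_(i))%MM = u by rewrite submK // lep1mP -lt0n.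
  have vE : (v - U_(i) + U_(i))%MM = v by rewrite submK // lep1mP -lt0n.
  move: uv; rewrite -uE -vE !adegD => /addIn uv.
  apply: congruentD; apply: low => //.
  by rewrite -[in X in (_ < X)%N]uE adegD adeg1 -[X in (X < _)%N]addn0 ltn_add2l.
- exact: rst_refl.
- apply: rst_trans (IHu low) _; apply: IHv => x y.
  by rewrite -(linked_adeg uv); apply: low.
Qed.

Lemma congruent_below B B' u v :
    toric_binomials a B ->
    (forall w z, B (binomial K w z) -> (adeg a w <= adeg a u)%N -> B' (binomial K w z)) ->
  congruent B u v -> congruent B' u v.
Proof.
move=> Btor sub uv.
elim: uv sub => {u v} [_ _ [w [z [m [Bwz -> ->]]]]|u|u v uv IH|u v w uv IHu vw IHv] sub.
- apply: rst_step; exists w, z, m; split=> //; apply: sub => //.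
  by rewrite adegD leq_addr.
- exact: rst_refl.
- by apply: rst_sym; apply: IH; rewrite (congruent_adeg Btor uv).
- apply: rst_trans (IHu sub) _.
  by apply: IHv; rewrite -(congruent_adeg Btor uv).
Qed.

(** A binomial with linked monomials is a combination of elements of smaller
    degree, so that a generating set remains one without it. *)
Lemma markov_basis_not_linked B u v : markov_basis a B -> B (binomial K u v) ->
  adeg a u = adeg a v /\ ~ linked u v.
Proof.
move=> [Btor Bgen Bmin] Buv.
have /toric_binomialP uvE : toric_ideal a (binomial K u v).
  by have [? [? []]] := Btor _ Buv.
split=> // uv; pose B' q := B q /\ q <> binomial K u v.
have B'tor : toric_binomials a B' by move=> q [/Btor].
have /(toric_generatedP Btor) Bcong := Bgen.
suff B'uv : congruent B' u v.
  have B'gen : same_set (ideal_gen B') (toric_ideal a).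
    move=> q; split; first by apply: ideal_gen_trans => r /B'tor[? [? []]].
    move=> /Bgen; apply: ideal_gen_trans => r Br.
    have [->|rb] := excluded_middle_informative (r = binomial K u v).
      exact: congruent_ideal.
    exact: ideal_gen_sub.
  by have [_ []] := Bmin B' (fun q => @proj1 _ _) B'gen _ Buv.
case: (eqVneq u v) => [->|/eqP neq_uv]; first exact: rst_refl.
apply: linked_congruent uv => x y lt_xu xy.
apply: congruent_below (Bcong _ _ xy) => // w z Bwz le_wx; split=> //.
move=> /(binomial_inj neq_uv)[] [wE zE]; move: le_wx; rewrite wE; lia.
Qed.

Section Star.
Variables (u0 v0 : 'X_{1..n}).
Hypotheses (uv0 : adeg a u0 = adeg a v0) (nl0 : ~ linked u0 v0).

(** The binomials joining a chosen monomial of each fibre to a representative of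
    each other linkage class of that fibre; here v0 is chosen in its fibre and u0
    represents its class, so that x^u0 - x^v0 belongs to this set. *)
Definition is_centre u w :=
  adeg a w = adeg a u /\ (adeg a u = adeg a v0 -> w = v0).

Definition centre u := epsilon (inhabits 0%MM) (is_centre u).

Definition is_representative u w := linked u w /\ (linked u u0 -> w = u0).

Definition representative u := epsilon (inhabits 0%MM) (is_representative u).

Definition star p :=
  exists u, p = binomial K (representative u) (centre u) /\ ~ linked u (centre u).

Lemma centreP u : is_centre u (centre u).
Proof.
apply: epsilon_spec; case: (eqVneq (adeg a u) (adeg a v0)) => [uv|/eqP uv].
  by exists v0; split.
by exists u.
Qed.

Lemma representativeP u : is_representative u (representative u).
Proof.
apply: epsilon_spec.
have [?|nu] := excluded_middle_informative (linked u u0); first by exists u0.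
by exists u; split=> //; apply: rt_refl.
Qed.

Lemma eq_centre u v : adeg a u = adeg a v -> centre u = centre v.
Proof. by rewrite /centre /is_centre => ->. Qed.

Lemma eq_representative u v : linked u v -> representative u = representative v.
Proof.
move=> uv; rewrite /representative; congr epsilon; apply: functional_extensionality.
have E w : linked u w = linked v w.
  apply: propositional_extensionality; split; last exact: linked_trans.
  by apply: linked_trans; apply: linked_sym.
by move=> w; rewrite /is_representative !E.
Qed.

Lemma star_adeg u : adeg a (representative u) = adeg a (centre u).
Proof. by rewrite -(linked_adeg (representativeP u).1) (centreP u).1. Qed.

Lemma star_toric : toric_binomials a star.
Proof.
move=> _ [u [-> _]]; exists (representative u), (centre u); split=> //.
by apply/toric_binomialP; apply: star_adeg.
Qed.

Lemma star_generates u v : adeg a u = adeg a v -> congruent star u v.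
Proof.
have [d] := ubnP (adeg a u); elim: d u v => // d IHd u v le_ud uv.
have to_centre w : adeg a w = adeg a u -> congruent star w (centre w).
  move=> wu; have low x y : (adeg a x < adeg a w)%N -> adeg a x = adeg a y ->
      congruent star x y.
    by move=> xw; apply: IHd; lia.
  have [lw|nlw] := excluded_middle_informative (linked w (centre w)).
    exact: linked_congruent low lw.
  apply: rst_trans (linked_congruent low (representativeP w).1) _.
  apply: rst_step; exists (representative w), (centre w), 0%MM.
  by rewrite !addm0; split=> //; exists w.
apply: rst_trans (to_centre u erefl) _; rewrite (eq_centre uv).
by apply: rst_sym; apply: to_centre.
Qed.

(** The only element of the star with a monomial in the linkage class of its
    representative is the edge itself, so without that edge the class is closed
    under the congruence. *)
Lemma star_minimal B' u : (forall p, B' p -> star p) -> ~ linked u (centre u) ->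
  ~ B' (binomial K (representative u) (centre u)) ->
  ~ congruent B' (representative u) (centre u).
Proof.
move=> B'star nlu nB'.
have closed x y : congruent B' x y -> linked u x <-> linked u y.
  elim=> {x y} [_ _ [w [z [m [Bwz -> ->]]]]|//|x y _ <- //|x y z _ -> _ -> //].
  have [v [wzE nlv]] := B'star _ Bwz.
  have nvE : representative v <> centre v.
    move=> vE; apply: nlv; rewrite -vE; exact: (representativeP v).1.
  have wz : adeg a w = adeg a z.
    by have [[-> ->]|[-> ->]] := binomial_inj nvE wzE; rewrite star_adeg.
  case: (eqVneq m 0%MM) => [->|m0]; last first.
    have wz_share : linked (w + m)%MM (z + m)%MM.
      apply: share_linked; split; first by rewrite !adegD wz.
      have /mnmP : m <> 0%MM by apply/eqP.
      move=> nm; have /existsP[i mi] : [exists i, m i != 0%N].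
        rewrite -negb_forall; apply/negP => /forallP m_eq0.
        by apply: nm => i; rewrite mnm0E; apply/eqP.
      by exists i; rewrite !mnmDE; lia.
    split; first by move/linked_trans; apply.
    by move/linked_trans; apply; apply: linked_sym.
  rewrite !addm0.
  have ends x : x = representative v \/ x = centre v -> ~ linked u x.
    move=> xE ux; have uv : adeg a u = adeg a v.
      rewrite (linked_adeg ux); case: xE => ->; last exact: (centreP v).1.
      by rewrite star_adeg (centreP v).1.
    case: xE ux => -> ux; last by apply: nlu; rewrite (eq_centre uv).
    have lv := (representativeP v).1.
    have luv : linked u v by apply: linked_trans ux (linked_sym lv).
    by apply: nB'; rewrite (eq_representative luv) (eq_centre uv) -wzE.
  by have [[-> ->]|[-> ->]] := binomial_inj nvE wzE;
    split=> /ends []; [left|right|right|left].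
by move=> /closed[/(_ (representativeP u).1)].
Qed.

Lemma star_markov : markov_basis a star.
Proof.
split; [exact: star_toric | | move=> B' B'star B'gen _ [u [-> nlu]]].
  by apply/(toric_generatedP star_toric); apply: star_generates.
have B'tor : toric_binomials a B' by move=> p /B'star/star_toric.
apply: NNPP => nB'; apply: (star_minimal B'star nlu nB').
by move/(toric_generatedP B'tor): B'gen; apply; apply: star_adeg.
Qed.

Lemma star_uv0 : star (binomial K u0 v0).
Proof.
exists u0; have cE : centre u0 = v0 by apply: (centreP u0).2.
have rE : representative u0 = u0 by apply: (representativeP u0).2; apply: rt_refl.
by rewrite cE rE.
Qed.
End Star.

(** In one direction, elements with linked monomials are redundant; in the other,
    the star is a Markov basis through any given binomial with unlinked
    monomials. *)
Lemma universal_markovP p : universal_markov a p <->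
  exists u v, [/\ p = binomial K u v, adeg a u = adeg a v & ~ linked u v].
Proof.
split=> [[B [mB Bp]]|[u [v [-> uv nl]]]].
  have [Btor _ _] := mB; have [u [v [pE _]]] := Btor _ Bp.
  rewrite pE in Bp; have [uv nl] := markov_basis_not_linked mB Bp.
  by exists u, v.
by exists (star u v); split; [apply: star_markov | apply: star_uv0].
Qed.

Lemma bettiP d : betti K a d <->
  exists u v, [/\ universal_markov a (binomial K u v), adeg a u = d & adeg a v = d].
Proof.
split=> [[B [u [v [mB Buv ->]]]]|[u [v [[B [mB Buv]] <- _]]]]; last by exists B, u, v.
have [uv _] := markov_basis_not_linked mB Buv.
by exists u, v; split=> //; exists B.
Qed.

End Markov.

(** * Critical binomials, Markov bases and the Graver basis *)

Section CriticalGraver.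
Variables (K : fieldType) (n : nat) (a : 'I_n -> nat).
Hypothesis a_gt0 : forall i, (0 < a i)%N.
Implicit Types (u v w z m : 'X_{1..n}) (p q : {mpoly K[n]}).

Lemma adeg_mulm1 i c : adeg a (U_(i) *+ c)%MM = (c * a i)%N.
Proof.
elim: c => [|c IH]; last by rewrite mulmS adegD adeg1 IH mulSn.
by rewrite mulm0n /adeg big1 // => j _; rewrite mnm0E.
Qed.

Lemma generated_exponents J s :
  generated a J s <->
  exists r : 'X_{1..n}, (forall i, i \notin J -> r i = 0%N) /\ s = adeg a r.
Proof.
split=> [[f ->]|[r [rJ ->]]].
  exists [multinom (if i \in J then f i else 0%N) | i < n].
  split=> [i /negPf iJ|]; first by rewrite mnmE iJ.
  rewrite /adeg big_mkcond; apply: eq_bigr => i _; rewrite mnmE.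
  by case: (i \in J).
exists r; rewrite /adeg [RHS]big_mkcond; apply: eq_bigr => i _.
by case: ifPn => // /rJ ->.
Qed.

(** The fibre of a critical exponent: a second monomial divisible by x_i would,
    after cancelling powers of x_i, contradict minimality. *)
Lemma critical_isolated i c w : critical_exponent a i c ->
  share a (U_(i) *+ c)%MM w -> w = (U_(i) *+ c)%MM.
Proof.
move=> [c0 _ cmin] [cw [j]]; rewrite mulmnE mnm1E.
case: eqVneq => [<-{j}|_] [wi0 wi]; last by [].
move: cw; rewrite adeg_mulm1 => cw.
pose r := [multinom (if j == i then 0 else w j)%N | j < n].
have wE : w = (U_(i) *+ w i + r)%MM.
  apply/mnmP => j; rewrite mnmDE mulmnE mnm1E mnmE [i == j]eq_sym.
  by case: eqVneq => [->|]; lia.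
have cE : (c * a i = w i * a i + adeg a r)%N.
  by rewrite cw {1}wE adegD adeg_mulm1.
have a0 := a_gt0 i.
have le_wc : (w i <= c)%N by nia.
have crE : ((c - w i) * a i)%N = adeg a r by rewrite mulnBl; lia.
have wc : w i = c.
  case: (ltngtP (w i) c) => //; last by lia.
  move=> lt_wc; have /cmin : (0 < c - w i)%N by lia.
  have gen : generated a [set~ i] ((c - w i) * a i).
    apply/generated_exponents; exists r; split=> // j.
    by rewrite !inE negbK mnmE => ->.
  by move=> /(_ gen); lia.
have /(adeg_eq0 a_gt0) r0 : adeg a r = 0%N by rewrite -crE wc; lia.
by rewrite wE r0 addm0 wc.
Qed.

Lemma critical_markov p : critical a p -> universal_markov a p.
Proof.
move=> [i [c [r [ccrit ri cr ->]]]]; apply/universal_markovP => //.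
exists (U_(i) *+ c)%MM, r; split; rewrite ?adeg_mulm1 ?mpolyXn //.
move=> /linked_isolated cE; have [c0 _ _] := ccrit.
have /mnmP/(_ i) : r = (U_(i) *+ c)%MM.
  by apply: cE => w; apply: critical_isolated.
by rewrite ri mulmnE mnm1E eqxx; lia.
Qed.

Lemma critical_betti i c : critical_exponent a i c -> betti K a (c * a i).
Proof.
move=> ccrit; have [c0 /generated_exponents[r [r0 cr]] _] := ccrit.
apply/bettiP => //; exists (U_(i) *+ c)%MM, r; rewrite adeg_mulm1 -cr; split=> //.
apply: critical_markov; exists i, c, r; rewrite mpolyXn; split=> //.
by apply: r0; rewrite !inE eqxx.
Qed.

Lemma critical_exponent_exists i c : (0 < c)%N ->
  generated a [set~ i] (c * a i) -> exists c', critical_exponent a i c'.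
Proof.
have [d] := ubnP c; elim: d c => // d IHd c le_cd c0 cgen.
have [[c' [c'0 c'gen lt_c]]|no] := excluded_middle_informative (exists c',
  [/\ (0 < c')%N, generated a [set~ i] (c' * a i) & (c' < c)%N]).
  by apply: (IHd c') => //; lia.
exists c; split=> // c' c'0 c'gen; rewrite leqNgt; apply/negP => lt_c.
by apply: no; exists c'.
Qed.

Lemma adeg_le_eq u v : (u <= v)%MM -> adeg a u = adeg a v -> u = v.
Proof.
move=> uv; rewrite -[in adeg a v](submK uv) adegD => E.
have /(adeg_eq0 a_gt0) vu0 : adeg a (v - u)%MM = 0%N by lia.
by rewrite -(submK uv) vu0 add0m.
Qed.

(** If x^w - x^z divides x^u - x^v properly, then u and v are both linked to
    the monomial obtained from u by replacing its factor x^w by x^z. *)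
Lemma markov_graver p : universal_markov a p -> graver a p.
Proof.
move=> /(universal_markovP a_gt0)[u [v [-> uv nl]]].
exists u, v; split=> //.
  apply/nonzero_toricP; split=> // uvE; apply: nl; rewrite uvE; exact: rt_refl.
move=> [w [z [neq /nonzero_toricP[wz wzE] wu zv]]].
have share_pos m k k' : m <> 0%MM -> adeg a (k + m)%MM = adeg a (k' + m)%MM ->
    linked a (k + m)%MM (k' + m)%MM.
  move=> m0 E; apply: share_linked; split=> //.
  case: (pickP (fun i => m i != 0%N)) => [i mi|mi0].
    by exists i; rewrite !mnmDE; lia.
  by case: m0; apply/mnmP => i; rewrite mnm0E; apply/eqP; move: (mi0 i) => /negbFE.
have uE := submK wu; have vE := submK zv.
have duv : adeg a (u - w)%MM = adeg a (v - z)%MM.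
  have : adeg a (u - w + w)%MM = adeg a (v - z + z)%MM by rewrite uE vE.
  by rewrite !adegD; lia.
case: (eqVneq (u - w)%MM 0%MM) => [uw0|/eqP uw0].
  have vz0 : (v - z)%MM = 0%MM.
    by apply: (adeg_eq0 a_gt0); rewrite -duv uw0 /adeg big1 // => i _; rewrite mnm0E.
  by apply: neq; rewrite -uE -vE uw0 vz0 !add0m.
have z0 : z <> 0%MM.
  move=> z0; apply: wz; rewrite z0; apply: (adeg_eq0 a_gt0).
  by rewrite wzE z0 /adeg big1 // => i _; rewrite mnm0E.
apply: nl; apply: (@linked_trans _ _ _ (u - w + z)%MM).
  rewrite -{1}uE ![((u - w) + _)%MM]addmC; apply: share_pos => //.
  by rewrite !adegD wzE.
by rewrite -{1}vE; apply: share_pos => //; rewrite !adegD duv.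
Qed.

Lemma graverP p : graver a p <-> exists u v, [/\ p = binomial K u v, u <> v,
  adeg a u = adeg a v & forall w z, (w <= u)%MM -> (z <= v)%MM -> w <> z ->
    adeg a w = adeg a z -> w = u /\ z = v].
Proof.
split=> [[u [v [-> /nonzero_toricP[neq uv] prim]]]|[u [v [-> neq uv prim]]]].
  exists u, v; split=> // w z wu zv wz wzE.
  case: (eqVneq (binomial K w z) (binomial K u v)) => [|/eqP neqb].
    case/(binomial_inj neq) => [//|[wv zu]]; case: neq.
    by apply: adeg_le_eq; rewrite // -zu.
  by case: prim; exists w, z; split=> //; apply/nonzero_toricP.
exists u, v; split=> //; first exact/nonzero_toricP.
move=> [w [z [neqb /nonzero_toricP[wz wzE] wu zv]]].
by case: neqb; have [-> ->] := prim w z wu zv wz wzE.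
Qed.

End CriticalGraver.

(** * Reduced Groebner bases with prescribed leading monomials *)

Section Groebner.
Variables (K : fieldType) (n : nat) (a : 'I_n -> nat) (le : rel 'X_{1..n}).
Hypothesis a_gt0 : forall i, (0 < a i)%N.
Hypothesis le_order : monomial_order le.
Implicit Types (u v w z m : 'X_{1..n}) (p q g : {mpoly K[n]}).

Let le_refl : reflexive le. Proof. by case: le_order => -[]. Qed.
Let le_anti : antisymmetric le. Proof. by case: le_order => -[]. Qed.
Let le_trans : transitive le. Proof. by case: le_order => -[]. Qed.
Let le_total : total le. Proof. by case: le_order => -[]. Qed.

Lemma lem_order u v : (u <= v)%MM -> le u v.
Proof.
move=> /submK <-; have [_ le0 leD] := le_order.
by have := leD 0%MM (v - u)%MM u (le0 _); rewrite add0m.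
Qed.

Lemma leading_mon_uniq p m m' : leading_mon le p m -> leading_mon le p m' -> m = m'.
Proof. by move=> [mp mmax] [m'p m'max]; apply: le_anti; rewrite m'max // mmax. Qed.

Lemma le_max_exists (s : seq 'X_{1..n}) : s != [::] ->
  exists2 m, m \in s & forall m', m' \in s -> le m' m.
Proof.
elim: s => // x [_ _|y s /(_ isT)[m ms mmax] _].
  by exists x; rewrite ?inE // => m'; rewrite inE => /eqP ->.
case/orP: (le_total x m) => xm.
  exists m; first by rewrite inE ms orbT.
  by move=> m'; rewrite inE => /orP[/eqP -> | /mmax].
exists x; first by rewrite inE eqxx.
move=> m'; rewrite inE => /orP[/eqP -> // | /mmax m'm].
exact: le_trans m'm xm.
Qed.

Lemma leading_mon_exists p : p != 0 -> exists m, leading_mon le p m.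
Proof.
by rewrite -msupp_eq0 => /le_max_exists[m mp mmax]; exists m.
Qed.

Lemma monomial_ideal_dvd (G : {mpoly K[n]} -> Prop) p m :
    (forall q, G q -> exists k, q = 'X_[k]) -> ideal_gen G p -> m \in msupp p ->
  exists k, G 'X_[k] /\ (k <= m)%MM.
Proof.
move=> Gmon [s [Gs ->]] /msupp_sum_le /flattenP[t /mapP[c]].
rewrite mem_filter => /= cs -> mc; have [k kE] := Gmon _ (Gs _ cs).
exists k; split; first by rewrite -kE; apply: Gs.
move: mc; rewrite kE (perm_mem (msuppMX _ _)) => /mapP[k' _ ->].
exact: lem_addr.
Qed.

(** A pair c stands for the binomial x^(c.1) - x^(c.2) with leading monomial
    x^(c.1). When no fibre has two monomials outside the ideal of the x^(c.1),
    these monomials generate the initial ideal. *)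
Variable s : seq ('X_{1..n} * 'X_{1..n}).
Definition standard u := forall c, c \in s -> ~~ (c.1 <= u)%MM.
Hypothesis s_adeg : forall c, c \in s -> adeg a c.1 = adeg a c.2.
Hypothesis s_le : forall c, c \in s -> le c.2 c.1 /\ c.2 <> c.1.
Hypothesis standard_uniq : forall u v,
  adeg a u = adeg a v -> standard u -> standard v -> u = v.

(** Replacing a factor c.1 by c.2 makes a monomial smaller within its finite
    fibre. *)
Lemma standard_below u : exists w, [/\ standard w, adeg a w = adeg a u & le w u].
Proof.
have mdeg_le m : adeg a m = adeg a u -> (mdeg m < (adeg a u).+1)%N.
  rewrite ltnS mdegE => <-; apply: leq_sum => i _.
  by rewrite -{1}[m i]muln1 leq_mul2l a_gt0 orbT.
pose u' : 'X_{1..n < (adeg a u).+1} := BMultinom (mdeg_le u erefl).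
have Pu' : adeg a u' == adeg a u by [].
case: (@extremumP _ _ le u' (fun m : 'X_{1..n < _} => adeg a m == adeg a u)
  (fun m : 'X_{1..n < _} => val m) le_refl le_trans le_total Pu')
  => -[w ltw] /= /eqP wu wmin.
exists w; split; [|by []|exact: (wmin u' Pu')].
move=> c cs; apply/negP => cw; have [c21 c21E] := s_le cs.
pose w2 := (w - c.1 + c.2)%MM; have wE := submK cw.
have w2u : adeg a w2 = adeg a u by rewrite -wu -wE !adegD s_adeg.
have /eqP w2P := w2u; have /= le_ww2 := wmin (BMultinom (mdeg_le w2 w2u)) w2P.
have [_ _ leD] := le_order; have := leD _ _ (w - c.1)%MM c21.
rewrite ![(_ + (_ - _))%MM]addmC wE => le_w2w.
have : w2 = w by apply: le_anti; rewrite le_w2w.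
by rewrite /w2 -{2}wE => /eqP; rewrite eqm_add2l => /eqP.
Qed.

(** A standard leading monomial would be the only monomial of its A-degree in
    the polynomial, contradicting that coefficients sum to 0 there. *)
Lemma toric_leading_mon p m : toric_ideal a p -> leading_mon le p m ->
  exists2 c, c \in s & (c.1 <= m)%MM.
Proof.
move=> pI [mp mmax]; apply: NNPP => nstd.
have stdm : standard m by move=> c cs; apply/negP => cm; apply: nstd; exists c.
have only u : u \in msupp p -> adeg a u = adeg a m -> u = m.
  move=> up um; have [w [stdw wu le_wu]] := standard_below u.
  have wm : w = m by apply: standard_uniq; rewrite ?wu.
  by apply: le_anti; rewrite mmax //= -wm.
have := toric_coef_sum (adeg a m) pI; rewrite /coef_sum big_mkcond.
rewrite (bigD1_seq m) ?msupp_uniq //= eqxx big_seq_cond big1 => [/eqP|u].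
  by rewrite addr0 mcoeff_eq0 mp.
by move=> /andP[up um]; case: eqP => // /(only _ up) uE; rewrite uE eqxx in um.
Qed.

Lemma leading_mon_pair c : c \in s -> leading_mon le (binomial K c.1 c.2) c.1.
Proof.
move=> cs; have [le21 /eqP neq21] := s_le cs; split.
  rewrite mcoeff_msupp mcoeffB !mcoeffX eqxx (negPf neq21) subr0.
  exact: oner_neq0.
move=> m; rewrite mcoeff_msupp mcoeffB !mcoeffX.
case: (eqVneq c.1 m) => [<-|_]; first by move=> _; apply: le_refl.
by case: (eqVneq c.2 m) => [<- //|_]; rewrite subrr eqxx.
Qed.

Lemma toric_pair c : c \in s -> toric_ideal a (binomial K c.1 c.2).
Proof. by move=> cs; apply/toric_binomialP; apply: s_adeg. Qed.

Lemma initial_ideal_monomials (G : {mpoly K[n]} -> Prop) q :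
  (exists p m, [/\ G p, leading_mon le p m & q = 'X_[m]]) -> exists k, q = 'X_[k].
Proof. by move=> [p [m [_ _ ->]]]; exists m. Qed.

Lemma mpolyX_inj u v : 'X_[u] = 'X_[v] :> {mpoly K[n]} -> u = v.
Proof. by move=> /(congr1 (fun p => msupp p)); rewrite !msuppX => -[]. Qed.

Hypothesis tails_standard : forall c, c \in s -> standard c.2.

(** Reducedness identifies the element whose leading monomial divides c.1; the
    difference between it and the binomial of c has only standard monomials, so
    it vanishes. *)
Lemma reduced_groebner_basis_mem G g :
  reduced_groebner_basis le (toric_ideal a) G -> g \in G ->
  exists2 c, c \in s & g = binomial K c.1 c.2.
Proof.
move=> [[GI Ggen] Gmonic Gred] gG; have [m [gm gm1]] := Gmonic g gG.
have below c : c \in s -> exists h k, [/\ h \in G, leading_mon le h k & (k <= c.1)%MM].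
  move=> cs; have : initial_ideal le (fun h => h \in G) ('X_[c.1] : {mpoly K[n]}).
    apply/Ggen; apply: ideal_gen_sub; exists (binomial K c.1 c.2), c.1.
    by split; [apply: toric_pair | apply: leading_mon_pair |].
  move=> /(@monomial_ideal_dvd _ _ c.1 (@initial_ideal_monomials _)).
  rewrite msuppX inE eqxx => /(_ isT)[k [[h [k' [hG hk' /mpolyX_inj ->]]] kc]].
  by exists h, k'.
have only_g c k : c \in s -> k \in msupp g -> (c.1 <= k)%MM -> (m <= c.1)%MM.
  move=> cs kg ck; have [h [k' [hG hk' k'c]]] := below c cs.
  case: (eqVneq h g) => [hg|/eqP hg].
    by rewrite hg in hk'; rewrite (leading_mon_uniq gm hk').
  by have := Gred _ _ _ _ gG hG hg hk' kg; rewrite (lepm_trans k'c ck).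
have [c cs cm] := toric_leading_mon (GI g gG) gm.
have mE : c.1 = m.
  apply: le_anti; rewrite !lem_order //.
  by apply: only_g cs _ cm; case: gm.
exists c => //; apply/eqP; rewrite -subr_eq0; apply: contraT => nz.
have [k kp] := leading_mon_exists nz.
have [c' c's c'k] : exists2 c', c' \in s & (c'.1 <= k)%MM.
  by apply: toric_leading_mon kp; apply: ideal_genB; [apply: GI | apply: toric_pair].
have km : k <> m.
  move=> km; case: kp; rewrite km mcoeff_msupp !mcoeffB gm1 !mcoeffX mE eqxx.
  by have [_ /eqP] := s_le cs; rewrite mE => /negPf ->; rewrite subr0 subrr eqxx.
have [kg|kc] : k \in msupp g \/ k = c.2.
  case: kp => /msuppB_le; rewrite mem_cat => /orP[kg|]; first by left.
  move=> /msuppB_le; rewrite mem_cat !msuppX !inE => /orP[|] /eqP; last by right.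
  by rewrite mE.
  case: km; apply: le_anti; case: (gm) => _ -> //.
  by rewrite lem_order // (lepm_trans (only_g _ _ c's kg c'k) c'k).
by have := tails_standard cs c's; rewrite -kc c'k.
Qed.

Hypothesis leads_incomparable : forall c c', c \in s -> c' \in s ->
  c <> c' -> ~~ (c.1 <= c'.1)%MM.

Lemma pairs_reduced_groebner_basis :
  reduced_groebner_basis le (toric_ideal a) [seq binomial K c.1 c.2 | c <- s].
Proof.
split=> [|_ /mapP[c cs ->]|_ _ m m' /mapP[c cs ->] /mapP[c' c's ->] neq].
- have sI g : g \in [seq binomial K c.1 c.2 | c <- s] -> toric_ideal a g.
    by move=> /mapP[c cs ->]; apply: toric_pair.
  split=> // q; split; apply: ideal_gen_trans => _ [p [m [pI pm ->]]].
    by apply: ideal_gen_sub; exists p, m; split=> //; apply: sI.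
  have [c cs cm] := toric_leading_mon pI pm.
  rewrite -(submK cm) mpolyXD; apply: ideal_genM; apply: ideal_gen_sub.
  exists (binomial K c.1 c.2), c.1; split=> //; last exact: leading_mon_pair.
  by apply/mapP; exists c.
- exists c.1; split; first exact: leading_mon_pair.
  have [_ /eqP] := s_le cs.
  by rewrite mcoeffB !mcoeffX eqxx => /negPf ->; rewrite subr0.
move=> /leading_mon_uniq /(_ (leading_mon_pair c's)) ->.
move=> /msuppB_le; rewrite mem_cat !msuppX !inE => /orP[] /eqP ->.
  by apply: leads_incomparable => // cc'; apply: neq; rewrite cc'.
exact: tails_standard.
Qed.

End Groebner.

(** * Three generators d2 d3, d1 d3, f3 d1 d2 *)

Lemma cancel_mod d c x y X Y : coprime d c ->
  (x * c + X * d = y * c + Y * d)%N -> x = y %[mod d].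
Proof.
move=> dc; wlog le_xy : x y X Y / (x <= y)%N => [hw E|E].
  case/orP: (leq_total x y) => xy; first exact: (hw _ _ X Y xy E).
  exact/esym/(hw _ _ Y X xy (esym E)).
apply/esym/eqP; rewrite eqn_mod_dvd //.
have : (d %| (y - x) * c)%N.
  have -> : ((y - x) * c = (X - Y) * d)%N by rewrite !mulnBl; lia.
  exact: dvdn_mull.
by rewrite Gauss_dvdl.
Qed.

Lemma mem_three (i1 i2 i3 : 'I_3) : uniq [:: i1; i2; i3] ->
  forall i, i \in [:: i1; i2; i3].
Proof.
move=> us; have [_ E] := @uniq_min_size _ [:: i1; i2; i3] (enum 'I_3) us
  (fun i _ => mem_enum _ i) (eq_leq (size_enum_ord 3)).
by move=> i; rewrite E mem_enum.
Qed.

Lemma perm_three (i1 i2 i3 : 'I_3) : uniq [:: i1; i2; i3] ->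
  perm_eq (index_enum 'I_3) [:: i1; i2; i3].
Proof.
move=> us; apply: uniq_perm => [||i] //; first exact: index_enum_uniq.
by rewrite mem_index_enum (mem_three us).
Qed.

Record labelled (a : 'I_3 -> nat) (i1 i2 i3 : 'I_3) (d1 d2 d3 f3 : nat) : Prop :=
  Labelled {
    lab_uniq : uniq [:: i1; i2; i3];
    lab_gen : [/\ a i1 = d2 * d3, a i2 = d1 * d3 & a i3 = f3 * d1 * d2]%N;
    lab_gt0 : [/\ 0 < d1, 0 < d2, 0 < d3 & 0 < f3]%N;
    lab_coprime : [/\ coprime d1 d2, coprime d1 d3, coprime d2 d3 & coprime f3 d3]
  }.

Lemma labelled_swap a i1 i2 i3 d1 d2 d3 f3 :
  labelled a i1 i2 i3 d1 d2 d3 f3 -> labelled a i2 i1 i3 d2 d1 d3 f3.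
Proof.
move=> [us [a1 a2 a3] [? ? ? ?] [c12 c13 c23 cf]]; split=> //.
- by move: us; rewrite /= !inE !negb_or [i2 == i1]eq_sym; lia.
- by split=> //; rewrite a3; lia.
- by split=> //; rewrite coprime_sym.
Qed.

Section Labelled.
Variables (K : fieldType) (a : 'I_3 -> nat) (i1 i2 i3 : 'I_3) (d1 d2 d3 f3 : nat).
Hypothesis lab : labelled a i1 i2 i3 d1 d2 d3 f3.
Implicit Types (u v w z m : 'X_{1..3}).

Lemma lab_a_gt0 i : (0 < a i)%N.
Proof.
have [us [a1 a2 a3] [? ? ? ?] _] := lab.
by have := mem_three us i; rewrite !inE => /or3P[] /eqP ->; rewrite ?a1 ?a2 ?a3; nia.
Qed.

Lemma lab_neq : [/\ (i1 == i2) = false, (i1 == i3) = false, (i2 == i3) = false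
  & [/\ (i2 == i1) = false, (i3 == i1) = false & (i3 == i2) = false]].
Proof.
have := lab_uniq lab; rewrite /= !inE negb_or andbT => /andP[/andP[n12 n13] n23].
rewrite ![i2 == i1]eq_sym ![i3 == _]eq_sym.
by split; [exact: negPf|exact: negPf|exact: negPf|split; exact: negPf].
Qed.

Definition mon3 p q r : 'X_{1..3} := (U_(i1) *+ p + U_(i2) *+ q + U_(i3) *+ r)%MM.

Lemma mon3E p q r :
  [/\ mon3 p q r i1 = p, mon3 p q r i2 = q & mon3 p q r i3 = r].
Proof.
have [e12 e13 e23 [e21 e31 e32]] := lab_neq.
by split; rewrite !mnmDE !mulmnE !mnm1E ?eqxx ?e12 ?e13 ?e23 ?e21 ?e31 ?e32; lia.
Qed.

Lemma mnm3P u v : [/\ u i1 = v i1, u i2 = v i2 & u i3 = v i3] -> u = v.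
Proof.
move=> [E1 E2 E3]; apply/mnmP => i.
by have := mem_three (lab_uniq lab) i; rewrite !inE => /or3P[] /eqP ->.
Qed.

Lemma mon3_le p q r u :
  (mon3 p q r <= u)%MM = [&& p <= u i1, q <= u i2 & r <= u i3]%N.
Proof.
have [E1 E2 E3] := mon3E p q r; apply/mnm_lepP/and3P => [le|[l1 l2 l3] i].
  by split; [rewrite -E1|rewrite -E2|rewrite -E3]; apply: le.
by have := mem_three (lab_uniq lab) i; rewrite !inE => /or3P[] /eqP ->;
  rewrite ?E1 ?E2 ?E3.
Qed.

Lemma adeg3 u :
  adeg a u = (u i1 * (d2 * d3) + u i2 * (d1 * d3) + u i3 * (f3 * d1 * d2))%N.
Proof.
have [us [a1 a2 a3] _ _] := lab.
by rewrite /adeg (perm_big _ (perm_three us)) /= !big_cons big_nil a1 a2 a3; lia.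
Qed.

(** Each d_i divides the two generators other than a_i and is coprime to a_i. *)
Lemma adeg_mod u v : adeg a u = adeg a v ->
  [/\ u i1 = v i1 %[mod d1], u i2 = v i2 %[mod d2] & u i3 = v i3 %[mod d3]].
Proof.
have [_ _ _ [c12 c13 c23 cf]] := lab; rewrite !adeg3 => E; split.
- apply: (@cancel_mod _ (d2 * d3) _ _ (u i2 * d3 + u i3 * f3 * d2)
    (v i2 * d3 + v i3 * f3 * d2)); last by nia.
  by rewrite coprimeMr c12.
- apply: (@cancel_mod _ (d1 * d3) _ _ (u i1 * d3 + u i3 * f3 * d1)
    (v i1 * d3 + v i3 * f3 * d1)); last by nia.
  by rewrite coprimeMr coprime_sym c12.
- apply: (@cancel_mod _ (f3 * d1 * d2) _ _ (u i1 * d2 + u i2 * d1)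
    (v i1 * d2 + v i2 * d1)); last by nia.
  by rewrite !coprimeMr coprime_sym cf coprime_sym c13 coprime_sym c23.
Qed.

Lemma adeg_dvd u v : adeg a u = adeg a v ->
  [/\ v i1 = 0%N -> (d1 %| u i1)%N, v i2 = 0%N -> (d2 %| u i2)%N
    & v i3 = 0%N -> (d3 %| u i3)%N].
Proof.
by move=> /adeg_mod[E1 E2 E3]; rewrite /dvdn; split=> v0;
  rewrite ?E1 ?E2 ?E3 v0 mod0n.
Qed.

Definition markov_pair u v :=
  (u = mon3 d1 0 0 /\ v = mon3 0 d2 0) \/
  exists k, [/\ (k <= f3)%N, u = mon3 0 0 d3 & v = mon3 ((f3 - k) * d1) (k * d2) 0].

Definition primitive u v := forall w z, (w <= u)%MM -> (z <= v)%MM -> w <> z ->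
  adeg a w = adeg a z -> w = u /\ z = v.

Lemma primitive_disjoint u v i : adeg a u = adeg a v -> u <> v -> primitive u v ->
  u i = 0%N \/ v i = 0%N.
Proof.
move=> uv neq prim.
have [|ui] := posnP (u i); first by left.
have [|vi] := posnP (v i); first by right.
have uE : (u - U_(i) + U_(i))%MM = u by rewrite submK // lep1mP -lt0n.
have vE : (v - U_(i) + U_(i))%MM = v by rewrite submK // lep1mP -lt0n.
have [] := prim _ _ (lem_subr u U_(i)) (lem_subr v U_(i)).
- by move=> E; apply: neq; rewrite -uE -vE E.
- by move: uv; rewrite -{1}uE -{1}vE !adegD => /addIn.
by move=> /mnmP/(_ i); rewrite mnmBE mnm1E eqxx; lia.
Qed.

(** If x^u is a power of x1, homogeneity makes x^u = x1^(x d1) and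
    x^v = x2^(y d2) x3^(z d3) with x = y + z f3, so that x1^d1 - x2^d2 divides the
    binomial when y > 0 and x1^(f3 d1) - x3^d3 does when y = 0. *)
Lemma primitive_first u v : adeg a u = adeg a v -> u <> v -> primitive u v ->
  u i2 = 0%N -> u i3 = 0%N -> v i1 = 0%N -> markov_pair u v \/ markov_pair v u.
Proof.
have [_ _ [d1p d2p d3p f3p] _] := lab.
move=> uv neq prim u2 u3 v1; have [/(_ v1)/dvdnP[x xE] _ _] := adeg_dvd uv.
have [_ /(_ u2)/dvdnP[y yE] /(_ u3)/dvdnP[z zE]] := adeg_dvd (esym uv).
have xyz : (x = y + z * f3)%N.
  have dp : (0 < d1 * d2 * d3)%N by rewrite !muln_gt0 d1p d2p.
  apply/eqP; rewrite -(eqn_pmul2r dp); apply/eqP.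
  by move: uv; rewrite !adeg3 u2 u3 v1 xE yE zE; lia.
have [y0|y0] := posnP y.
  have z0 : (0 < z)%N.
    rewrite lt0n; apply/eqP => z0; apply: neq; apply: mnm3P.
    by rewrite u2 u3 v1 xE yE zE xyz y0 z0.
  have [] := prim (mon3 (f3 * d1) 0 0) (mon3 0 0 d3).
  - by rewrite mon3_le xE xyz y0; nia.
  - by rewrite mon3_le zE; nia.
  - by move=> /mnmP/(_ i1); have [-> _ _] := mon3E (f3 * d1) 0 0;
      have [-> _ _] := mon3E 0 0 d3; nia.
  - by rewrite !adeg3; have [-> -> ->] := mon3E (f3 * d1) 0 0;
      have [-> -> ->] := mon3E 0 0 d3; nia.
  by move=> <- <-; right; right; exists 0%N; rewrite subn0.
have [] := prim (mon3 d1 0 0) (mon3 0 d2 0).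
- by rewrite mon3_le xE xyz; nia.
- by rewrite mon3_le yE; nia.
- by move=> /mnmP/(_ i1); have [-> _ _] := mon3E d1 0 0;
    have [-> _ _] := mon3E 0 d2 0; lia.
- by rewrite !adeg3; have [-> -> ->] := mon3E d1 0 0;
    have [-> -> ->] := mon3E 0 d2 0; nia.
by move=> <- <-; left; left.
Qed.

Lemma primitive_third u v : adeg a u = adeg a v -> u <> v -> primitive u v ->
  u i1 = 0%N -> u i2 = 0%N -> v i3 = 0%N -> markov_pair u v.
Proof.
have [_ _ [d1p d2p d3p f3p] _] := lab.
move=> uv neq prim u1 u2 v3; have [_ _ /(_ v3)/dvdnP[z zE]] := adeg_dvd uv.
have [/(_ u1)/dvdnP[x xE] /(_ u2)/dvdnP[y yE] _] := adeg_dvd (esym uv).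
have xyz : (z * f3 = x + y)%N.
  have dp : (0 < d1 * d2 * d3)%N by rewrite !muln_gt0 d1p d2p.
  apply/eqP; rewrite -(eqn_pmul2r dp); apply/eqP.
  by move: uv; rewrite !adeg3 u1 u2 v3 xE yE zE; lia.
have z0 : (0 < z)%N.
  rewrite lt0n; apply/eqP => z0; apply: neq; apply: mnm3P.
  by rewrite u1 u2 v3 xE yE zE; split; nia.
(* As x + y = z f3 >= f3, x^v has a factor with f3 blocks, each of them
   x1^d1 or x2^d2; k is the number of blocks of the second kind. *)
pose k := minn y f3.
have [] := prim (mon3 0 0 d3) (mon3 ((f3 - k) * d1) (k * d2) 0).
- by rewrite mon3_le zE; nia.
- have le_x : (f3 - k <= x)%N by rewrite /k; nia.
  by rewrite mon3_le xE yE !leq_mul2r le_x geq_minl !orbT.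
- by move=> /mnmP/(_ i3); have [_ _ ->] := mon3E 0 0 d3;
    have [_ _ ->] := mon3E ((f3 - k) * d1) (k * d2) 0; lia.
- have kf : (k <= f3)%N by exact: geq_minr.
  rewrite !adeg3; have [-> -> ->] := mon3E 0 0 d3.
  have [-> -> ->] := mon3E ((f3 - k) * d1) (k * d2) 0.
  by rewrite -{1}(subnK kf); nia.
by move=> <- <-; right; exists k; rewrite geq_minr.
Qed.

Lemma mon3X p q r :
  'X_[mon3 p q r] = 'X_i1 ^+ p * 'X_i2 ^+ q * 'X_i3 ^+ r :> {mpoly K[3]}.
Proof. by rewrite !mpolyXD -!mpolyXn. Qed.

Definition markov_list (p : {mpoly K[3]}) :=
  p = 'X_i1 ^+ d1 - 'X_i2 ^+ d2 \/
  exists k, (k <= f3)%N /\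
    p = 'X_i3 ^+ d3 - 'X_i1 ^+ ((f3 - k) * d1) * 'X_i2 ^+ (k * d2).

Lemma markov_listP p :
  markov_list p <-> exists u v, p = binomial K u v /\ markov_pair u v.
Proof.
have E1 : binomial K (mon3 d1 0 0) (mon3 0 d2 0) = 'X_i1 ^+ d1 - 'X_i2 ^+ d2.
  by rewrite /binomial !mon3X !expr0 !mulr1 mul1r.
have E2 k : binomial K (mon3 0 0 d3) (mon3 ((f3 - k) * d1) (k * d2) 0) =
    'X_i3 ^+ d3 - 'X_i1 ^+ ((f3 - k) * d1) * 'X_i2 ^+ (k * d2).
  by rewrite /binomial !mon3X !expr0 !mulr1 mul1r.
split=> [[->|[k [kf ->]]]|[u [v [-> [[-> ->]|[k [kf -> ->]]]]]]].
- by exists (mon3 d1 0 0), (mon3 0 d2 0); split=> //; left.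
- exists (mon3 0 0 d3), (mon3 ((f3 - k) * d1) (k * d2) 0).
  by split=> //; right; exists k.
- by left.
- by right; exists k.
Qed.

Lemma markov_pair_adeg u v : markov_pair u v ->
  adeg a u = adeg a v /\ (adeg a u = d1 * d2 * d3 \/ adeg a u = f3 * d1 * d2 * d3)%N.
Proof.
case=> [[-> ->]|[k [kf -> ->]]]; rewrite !adeg3.
  have [-> -> ->] := mon3E d1 0 0; have [-> -> ->] := mon3E 0 d2 0.
  by split; last left; lia.
have [-> -> ->] := mon3E 0 0 d3.
have [-> -> ->] := mon3E ((f3 - k) * d1) (k * d2) 0.
by move: (f3 - k)%N (subnK kf) => e <-; split; last right; lia.
Qed.

Lemma critical_exponent_first : critical_exponent a i1 d1.
Proof.
have [_ [a1 a2 _] [d1p _ _ _] _] := lab; split=> //.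
  apply/generated_exponents; exists (mon3 0 d2 0).
  have [E1 E2 E3] := mon3E 0 d2 0; rewrite adeg3 E1 E2 E3; split=> [i|].
    by rewrite !inE negbK => /eqP ->.
  by rewrite a1; nia.
move=> c c0 /generated_exponents[r [r0 cr]].
have := @adeg_dvd (U_(i1) *+ c)%MM r; rewrite adeg_mulm1 => /(_ cr)[+ _ _].
rewrite mulmnE mnm1E eqxx mul1n r0 ?inE ?eqxx // => /(_ erefl).
exact: dvdn_leq.
Qed.

Lemma critical_exponent_third : critical_exponent a i3 d3.
Proof.
have [_ [_ a2 a3] [_ _ d3p _] _] := lab; split=> //.
  apply/generated_exponents; exists (mon3 0 (f3 * d2) 0).
  have [E1 E2 E3] := mon3E 0 (f3 * d2) 0; rewrite adeg3 E1 E2 E3; split=> [i|].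
    by rewrite !inE negbK => /eqP ->.
  by rewrite a3; nia.
move=> c c0 /generated_exponents[r [r0 cr]].
have := @adeg_dvd (U_(i3) *+ c)%MM r; rewrite adeg_mulm1 => /(_ cr)[_ _ +].
rewrite mulmnE mnm1E eqxx mul1n r0 ?inE ?eqxx // => /(_ erefl).
exact: dvdn_leq.
Qed.

Lemma markov_list_critical p : markov_list p -> critical a p.
Proof.
have [_ [a1 _ a3] _ _] := lab.
case=> [->|[k [kf ->]]].
  exists i1, d1, (mon3 0 d2 0); rewrite mon3X !expr0 mul1r mulr1.
  have [E1 E2 E3] := mon3E 0 d2 0; rewrite adeg3 E1 E2 E3 a1; split=> //; last by lia.
  exact: critical_exponent_first.
exists i3, d3, (mon3 ((f3 - k) * d1) (k * d2) 0); rewrite mon3X expr0 mulr1.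
have [E1 E2 E3] := mon3E ((f3 - k) * d1) (k * d2) 0.
rewrite adeg3 E1 E2 E3 a3; split=> //; last first.
  by move: (f3 - k)%N (subnK kf) => e <-; lia.
exact: critical_exponent_third.
Qed.

End Labelled.

Section LabelledSets.
Variables (K : fieldType) (a : 'I_3 -> nat) (i1 i2 i3 : 'I_3) (d1 d2 d3 f3 : nat).
Hypothesis lab : labelled a i1 i2 i3 d1 d2 d3 f3.
Implicit Types (u v w z m : 'X_{1..3}).

Local Notation mpair := (markov_pair i1 i2 i3 d1 d2 d3 f3).

Lemma primitive_sym u v : primitive a u v -> primitive a v u.
Proof.
move=> prim w z wv zu wz wzE.
by have [-> ->] := prim z w zu wv (nesym wz) (esym wzE).
Qed.

Lemma markov_pair_swap u v :
  markov_pair i2 i1 i3 d2 d1 d3 f3 u v -> mpair u v \/ mpair v u.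
Proof.
have E p q r : mon3 i2 i1 i3 p q r = mon3 i1 i2 i3 q p r.
  by rewrite /mon3 [(U_(i2) *+ p + _)%MM]addmC.
rewrite /markov_pair !E => -[[-> ->]|[k [kf -> ->]]]; first by right; left.
by left; right; exists (f3 - k)%N; rewrite !E leq_subr subKn.
Qed.

(** The three coordinates are distributed between the two coprime monomials;
    neither can be 1, and otherwise one of them is a pure power. *)
Lemma primitive_markov_pair u v : adeg a u = adeg a v -> u <> v ->
  primitive a u v -> mpair u v \/ mpair v u.
Proof.
move=> uv neq prim; have lab' := labelled_swap lab.
have primV := primitive_sym prim; have vu := esym uv; have neqV := nesym neq.
have not0 w : w i1 = 0%N -> w i2 = 0%N -> w i3 = 0%N -> w = 0%MM.
  by move=> w1 w2 w3; apply: (mnm3P lab); rewrite !mnm0E.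
have adeg0 w z : adeg a w = adeg a z -> w = 0%MM -> w = z.
  move=> + w0; rewrite w0 {1}/adeg big1 => [|i _]; last by rewrite mnm0E.
  by move=> /esym/(adeg_eq0 (lab_a_gt0 lab)) ->.
have dj i := primitive_disjoint i uv neq prim.
have [u1|v1] := dj i1; have [u2|v2] := dj i2; have [u3|v3] := dj i3.
- by case: neq; apply: (adeg0 _ _ uv); apply: not0.
- by left; apply: (primitive_third lab).
- have [] := primitive_first lab' uv neq prim u1 u3 v2 => /markov_pair_swap; tauto.
- by have [] := primitive_first lab vu neqV primV v2 v3 u1; [right | left].
- exact: (primitive_first lab uv neq prim u2 u3 v1).
- have [] := primitive_first lab' vu neqV primV v1 v3 u2 => /markov_pair_swap; tauto.
- by right; apply: (primitive_third lab).
- by case: neqV; apply: (adeg0 _ _ vu); apply: not0.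
Qed.

Local Notation mlist := (@markov_list K i1 i2 i3 d1 d2 d3 f3).

Lemma graver_markov_list p : graver a p -> exists u v,
  [/\ p = binomial K u v, u <> v, mpair u v \/ mpair v u & mlist p \/ mlist (- p)].
Proof.
move=> /(graverP (lab_a_gt0 lab))[u [v [-> neq uv prim]]].
have uvP := primitive_markov_pair uv neq prim.
exists u, v; split=> //; case: uvP => uvP; [left | right; rewrite binomialN].
  by apply/markov_listP; exists u, v.
by apply/markov_listP; exists v, u.
Qed.

(** A cycle of inclusions, whose two middle links hold for all generators. *)
Lemma markov_sets p :
  [/\ mlist p -> critical a p, critical a p -> universal_markov a p,
      universal_markov a p -> graver a p & graver a p -> mlist p \/ mlist (- p)].
Proof.
have a_gt0 := lab_a_gt0 lab; split.
- exact: markov_list_critical.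
- exact: critical_markov.
- exact: markov_graver.
- by move/graver_markov_list => [u [v []]].
Qed.

Lemma betti_labelled d :
  betti K a d <-> d = (d1 * d2 * d3)%N \/ d = (f3 * d1 * d2 * d3)%N.
Proof.
have a_gt0 := lab_a_gt0 lab; have [_ [a1 _ a3] _ _] := lab; split.
  move=> /(bettiP K a_gt0)[u [v [/(markov_graver a_gt0)/graver_markov_list]]].
  move=> [u' [v' [uvE neq uvP _]]] <- _.
  have [E degs] : adeg a u' = adeg a v' /\
      (adeg a u' = d1 * d2 * d3 \/ adeg a u' = f3 * d1 * d2 * d3)%N.
    by case: uvP => /(markov_pair_adeg lab)[E]; rewrite E.
  by case: (binomial_inj neq uvE) => -[-> _]; rewrite -?E.
case=> ->.
  have -> : (d1 * d2 * d3 = d1 * a i1)%N by rewrite a1 mulnA.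
  exact: (critical_betti K a_gt0 (critical_exponent_first lab)).
have -> : (f3 * d1 * d2 * d3 = d3 * a i3)%N by rewrite a3 mulnC.
exact: (critical_betti K a_gt0 (critical_exponent_third lab)).
Qed.

End LabelledSets.

(** * Circuits *)

(** Both sides are the reduced form of one fraction. The exponents of a circuit
    are of this kind, for the ratio of two generators. *)
Lemma coprime_ratio p q r s : coprime p q -> coprime r s -> (0 < r)%N ->
  (p * s = q * r)%N -> p = r /\ q = s.
Proof.
move=> pq rs r0 E.
have pr : (p %| r)%N by rewrite -(Gauss_dvdr _ pq) -E dvdn_mulr.
have rp : (r %| p)%N by rewrite -(Gauss_dvdl _ rs) E dvdn_mull.
have prE : p = r by apply/eqP; rewrite eqn_dvd pr.
by split=> //; move: E; rewrite prE [(q * r)%N]mulnC => /eqP; rewrite eqn_pmul2l // => /eqP.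
Qed.

Section Circuits.
Variables (K : fieldType) (n : nat) (a : 'I_n -> nat).
Hypothesis a_gt0 : forall i, (0 < a i)%N.
Implicit Types (u v w z m : 'X_{1..n}).

(** In one variable the A-degree determines the monomial. *)
Lemma toric_support u v i : u <> v -> adeg a u = adeg a v ->
  exists2 j, j != i & j \in supp2 u v.
Proof.
move=> neq uv; apply: NNPP => no; apply: neq.
have uv0 j : j != i -> u j = 0%N /\ v j = 0%N.
  move=> ji; have : j \notin supp2 u v by apply/negP => js; apply: no; exists j.
  by rewrite inE negb_or !negbK => /andP[/eqP ? /eqP ?].
have adeg_i w : (forall j, j != i -> w j = 0%N) -> adeg a w = (w i * a i)%N.
  by move=> w0; rewrite /adeg (bigD1 i) //= big1 ?addn0 // => j /w0 ->.
apply/mnmP => j; case: (eqVneq j i) => [->|ji]; last by have [-> ->] := uv0 j ji.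
apply/eqP; rewrite -(eqn_pmul2r (a_gt0 i)); apply/eqP.
by rewrite -!adeg_i // => k /uv0[].
Qed.

Lemma supp2_powers (j k : 'I_n) x y : (0 < x)%N -> (0 < y)%N ->
  supp2 (U_(j) *+ x)%MM (U_(k) *+ y)%MM = [set j; k].
Proof.
move=> x0 y0; apply/setP => i; rewrite !inE !mulmnE !mnm1E ![_ == i]eq_sym.
by case: (i == j); case: (i == k); lia.
Qed.

(** For j in the support of u and k in that of v, a power of x_j minus a power of
    x_k lies in the toric ideal, so by minimality the support is {j, k}. *)
Lemma circuit_shape p : circuits a p -> exists j k x y,
  [/\ j != k, coprime x y, (0 < x)%N, (x * a j = y * a k)%N
    & p = binomial K (U_(j) *+ x)%MM (U_(k) *+ y)%MM].
Proof.
move=> [u [v [pE pI [dj gcd1] smin]]].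
have uv : adeg a u = adeg a v by apply/(@toric_binomialP K); rewrite -pE.
have pos_var w : w != 0%MM -> exists i, w i != 0%N.
  move=> w0; apply: NNPP => no; move/eqP: w0; apply; apply/mnmP => i.
  by rewrite mnm0E; apply/eqP; apply/negP => /negP wi; apply: no; exists i.
have adeg0 w z : adeg a w = adeg a z -> w = 0%MM -> z = 0%MM.
  move=> + w0; rewrite w0 {1}/adeg big1 => [|i _]; last by rewrite mnm0E.
  by move=> /esym/(adeg_eq0 a_gt0).
have u0 : u != 0%MM.
  apply/eqP => u0; have v0 := adeg0 _ _ uv u0.
  by move: gcd1; rewrite u0 v0 big1 // => i _; rewrite mnm0E.
have v0 : v != 0%MM by apply/eqP => /(adeg0 _ _ (esym uv)) /eqP; apply/negP.
have [[j uj] [k vk]] := (pos_var u u0, pos_var v v0).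
have jk : j != k by apply: contraNneq vk => <-; case: (dj j) uj => ->.
have ajp := a_gt0 j; have akp := a_gt0 k.
have nz : nonzero_toric K a (U_(j) *+ a k)%MM (U_(k) *+ a j)%MM.
  apply/nonzero_toricP; rewrite !adeg_mulm1 mulnC; split=> // /mnmP/(_ j).
  by rewrite !mulmnE !mnm1E eqxx [k == j]eq_sym (negPf jk); lia.
have supp_jk i : i != j -> i != k -> u i = 0%N /\ v i = 0%N.
  move=> ij ik; have := smin _ _ nz; rewrite supp2_powers // properE negb_and negbK.
  case/orP=> [/negP[]|/subsetP/(_ i)].
    by apply/subsetP => l; rewrite !inE => /orP[] /eqP ->; rewrite ?uj ?vk ?orbT.
  rewrite !inE (negPf ij) (negPf ik) /=.
  by case: (u i) => [|?]; case: (v i) => [|?] //= /(_ isT).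
have vj : v j = 0%N by case: (dj j) uj => ->.
have uk : u k = 0%N by case: (dj k) vk => ->.
have uE : u = (U_(j) *+ u j)%MM.
  apply/mnmP => i; rewrite mulmnE mnm1E; case: (eqVneq j i) => [->|]; first by lia.
  rewrite eq_sym => ij; case: (eqVneq i k) => [->|ik]; first by rewrite uk.
  by rewrite (supp_jk i ij ik).1.
have vE : v = (U_(k) *+ v k)%MM.
  apply/mnmP => i; rewrite mulmnE mnm1E; case: (eqVneq k i) => [->|]; first by lia.
  rewrite eq_sym => ik; case: (eqVneq i j) => [->|ij]; first by rewrite vj.
  by rewrite (supp_jk i ij ik).2.
exists j, k, (u j), (v k); rewrite lt0n; split=> //.
- move: gcd1; rewrite (bigD1 j) //= (bigD1 k) 1?eq_sym //= big1 => [|i /andP[ij ik]].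
    by rewrite vj uk addn0 add0n gcdn0 => /eqP.
  by have [-> ->] := supp_jk i ij ik.
- by rewrite -!adeg_mulm1 -uE -vE.
by rewrite -uE -vE.
Qed.

Lemma powers_circuit j k x y :
    j != k -> coprime x y -> (0 < x)%N -> (x * a j = y * a k)%N ->
  circuits a (binomial K (U_(j) *+ x)%MM (U_(k) *+ y)%MM).
Proof.
move=> jk xy x0 xyE; have ajp := a_gt0 j; have akp := a_gt0 k.
have y0 : (0 < y)%N by nia.
exists (U_(j) *+ x)%MM, (U_(k) *+ y)%MM; split=> //.
- by apply/toric_binomialP; rewrite !adeg_mulm1.
- split=> [i|].
    rewrite !mulmnE !mnm1E; case: (eqVneq j i) => [<-|]; last by left.
    by rewrite eq_sym (negPf jk); right.
  rewrite (bigD1 j) //= (bigD1 k) 1?eq_sym //= big1 => [|i /andP[ij ik]].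
    rewrite !mulmnE !mnm1E !eqxx [k == j]eq_sym (negPf jk) !mul1n !mul0n.
    by rewrite addn0 add0n gcdn0; apply/eqP.
  by rewrite !mulmnE !mnm1E ![_ == i]eq_sym (negPf ij) (negPf ik).
move=> w z /nonzero_toricP[neq wz]; rewrite supp2_powers //; apply/negP => /properP.
move=> [/subsetP sub [l]]; rewrite !inE => ljk lwz.
have [i il si] := toric_support l neq wz.
have [i' i'i si'] := toric_support i neq wz.
have i'l : i' != l by apply: contraNneq lwz => <-; move: si'; rewrite inE.
have := sub _ si; have := sub _ si'; rewrite !inE.
by case/orP: ljk il i'i i'l => /eqP -> il i'i i'l /orP[]/eqP E' /orP[]/eqP E;
  move: il i'i i'l; rewrite E E' eqxx.
Qed.

End Circuits.

Section LabelledCircuits.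
Variables (K : fieldType) (a : 'I_3 -> nat) (i1 i2 i3 : 'I_3) (d1 d2 d3 f3 : nat).
Hypothesis lab : labelled a i1 i2 i3 d1 d2 d3 f3.

Definition circuit_list (p : {mpoly K[3]}) :=
  [\/ p = 'X_i1 ^+ d1 - 'X_i2 ^+ d2, p = 'X_i1 ^+ (f3 * d1) - 'X_i3 ^+ d3
    | p = 'X_i2 ^+ (f3 * d2) - 'X_i3 ^+ d3].


Lemma circuit_listP p : circuits a p ->
  circuit_list p \/ circuit_list (- p).
Proof.
have [us [a1 a2 a3] [d1p d2p d3p f3p] [c12 c13 c23 cf]] := lab.
have c13' : coprime (f3 * d1) d3 by rewrite coprimeMl cf.
have c23' : coprime (f3 * d2) d3 by rewrite coprimeMl cf.
have ratio x y r s c : (0 < c)%N -> (0 < r)%N -> coprime x y -> coprime r s ->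
    (x * (c * s) = y * (c * r))%N -> x = r /\ y = s.
  move=> c0 r0 xy rs E; apply: coprime_ratio => //.
  by apply/eqP; rewrite -(eqn_pmul2l c0); apply/eqP; lia.
move=> /(circuit_shape (lab_a_gt0 lab))[j [k [x [y [jk xy x0 E ->]]]]].
have y0 : (0 < y)%N by have := lab_a_gt0 lab j; nia.
rewrite /circuit_list binomialN /binomial -!mpolyXn.
have := mem_three us k; have := mem_three us j; rewrite !inE.
move=> /or3P[]/eqP jE /or3P[]/eqP kE; rewrite ?jE ?kE ?eqxx // in jk E *;
  rewrite ?a1 ?a2 ?a3 in E.
- have [-> ->] := ratio x y d1 d2 d3 d3p d1p xy c12 ltac:(lia).
  by left; constructor 1.
- have [-> ->] := ratio x y (f3 * d1)%N d3 d2 d2p ltac:(nia) xy c13' ltac:(lia).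
  by left; constructor 2.
- have [-> ->] := ratio y x d1 d2 d3 d3p d1p ltac:(by rewrite coprime_sym) c12 ltac:(lia).
  by right; constructor 1.
- have [-> ->] := ratio x y (f3 * d2)%N d3 d1 d1p ltac:(nia) xy c23' ltac:(lia).
  by left; constructor 3.
- have [-> ->] := ratio y x (f3 * d1)%N d3 d2 d2p ltac:(nia)
    ltac:(by rewrite coprime_sym) c13' ltac:(lia).
  by right; constructor 2.
have [-> ->] := ratio y x (f3 * d2)%N d3 d1 d1p ltac:(nia)
  ltac:(by rewrite coprime_sym) c23' ltac:(lia).
by right; constructor 3.
Qed.

Lemma circuit_list_circuit p : circuit_list p -> circuits a p.
Proof.
have [_ [a1 a2 a3] [d1p d2p d3p f3p] [c12 c13 c23 cf]] := lab.
have [n12 n13 n23 _] := lab_neq lab; have a_gt0 := lab_a_gt0 lab.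
case=> ->; rewrite !mpolyXn; apply: powers_circuit => //;
  rewrite ?n12 ?n13 ?n23 ?muln_gt0 ?f3p ?a1 ?a2 ?a3 //.
- by lia.
- by rewrite coprimeMl cf.
- by lia.
- by rewrite coprimeMl cf.
by lia.
Qed.

End LabelledCircuits.

(** * Groebner bases *)

Section LabelledGroebner.
Variables (K : fieldType) (a : 'I_3 -> nat) (i1 i2 i3 : 'I_3) (d1 d2 d3 f3 : nat).
Hypothesis lab : labelled a i1 i2 i3 d1 d2 d3 f3.
Implicit Types (u v w z m : 'X_{1..3}).

Local Notation mon := (mon3 i1 i2 i3).

(** The leading monomials x1^d1 and x3^d3: exponents of x1 below d1 and of x3
    below d3 are determined by their residues, hence by the A-degree. *)
Lemma standard_first_third u v : adeg a u = adeg a v ->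
    (u i1 < d1)%N -> (u i3 < d3)%N -> (v i1 < d1)%N -> (v i3 < d3)%N -> u = v.
Proof.
have [_ _ [d1p _ d3p _] _] := lab.
move=> uv u1 u3 v1 v3; have [E1 _ E3] := adeg_mod lab uv.
rewrite !modn_small // in E1 E3; apply: (mnm3P lab); split=> //.
move: uv; rewrite !(adeg3 lab) E1 E3 => /addIn/addnI/eqP.
by rewrite eqn_pmul2r ?muln_gt0 ?d1p // => /eqP.
Qed.

(** The leading monomials x1^d1 and x2^(f3 d2), by the same argument modulo
    f3 d2 once the powers of x1 are known to agree. *)
Lemma standard_first_second u v : adeg a u = adeg a v ->
    (u i1 < d1)%N -> (u i2 < f3 * d2)%N -> (v i1 < d1)%N -> (v i2 < f3 * d2)%N ->
  u = v.
Proof.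
have [_ _ [d1p d2p d3p f3p] [_ _ c23 cf]] := lab.
move=> uv u1 u2 v1 v2; have [E1 _ _] := adeg_mod lab uv.
rewrite !modn_small // in E1.
have uv' : (u i2 * d3 + u i3 * (f3 * d2) = v i2 * d3 + v i3 * (f3 * d2))%N.
  apply/eqP; rewrite -(eqn_pmul2r d1p); apply/eqP.
  by move: uv; rewrite !(adeg3 lab) E1; lia.
have : u i2 = v i2 %[mod f3 * d2].
  by apply: cancel_mod uv'; rewrite coprimeMl cf c23.
rewrite !modn_small // => E2; apply: (mnm3P lab); split=> //.
move: uv'; rewrite E2 => /addnI/eqP.
by rewrite eqn_pmul2r ?muln_gt0 ?f3p // => /eqP.
Qed.

Section Order.
Variable le : rel 'X_{1..3}.
Hypothesis le_order : monomial_order le.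

Let pairs13 := [:: (mon d1 0 0, mon 0 d2 0); (mon 0 0 d3, mon 0 (f3 * d2) 0)].
Let pairs12 t := [:: (mon d1 0 0, t); (mon 0 (f3 * d2) 0, mon 0 0 d3)].

Lemma mon_neq p q r p' q' r' : (p != p') || (q != q') || (r != r') ->
  mon p q r <> mon p' q' r'.
Proof.
have [E1 E2 E3] := mon3E lab p q r; have [E1' E2' E3'] := mon3E lab p' q' r'.
move=> neq E; rewrite E in E1 E2 E3.
by rewrite -E1 -E2 -E3 E1' E2' E3' !eqxx in neq.
Qed.

Lemma mon_le p q r p' q' r' : (mon p q r <= mon p' q' r')%MM =
  [&& p <= p', q <= q' & r <= r']%N.
Proof. by rewrite (mon3_le lab); have [-> -> ->] := mon3E lab p' q' r'. Qed.

Lemma adeg_mon p q r :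
  adeg a (mon p q r) = (p * (d2 * d3) + q * (d1 * d3) + r * (f3 * d1 * d2))%N.
Proof. by rewrite (adeg3 lab); have [-> -> ->] := mon3E lab p q r. Qed.

Lemma pair_seqP (A : eqType) (x y : A) (P : A -> Prop) :
  P x -> P y -> forall c, c \in [:: x; y] -> P c.
Proof. by move=> Px Py c; rewrite !inE => /orP[] /eqP ->. Qed.

Hypothesis le21 : le (mon 0 d2 0) (mon d1 0 0).

Lemma pairs13_standardP u : standard pairs13 u <-> (u i1 < d1)%N /\ (u i3 < d3)%N.
Proof.
split=> [std|[u1 u3]]; last by apply: pair_seqP; rewrite (mon3_le lab) /=; lia.
have := std _ (mem_head _ _).
have := std (mon 0 0 d3, mon 0 (f3 * d2) 0); rewrite !inE eqxx orbT => /(_ isT).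
by rewrite !(mon3_le lab) /=; lia.
Qed.

Lemma pairs12_standardP t u :
  standard (pairs12 t) u <-> (u i1 < d1)%N /\ (u i2 < f3 * d2)%N.
Proof.
split=> [std|[u1 u2]]; last by apply: pair_seqP; rewrite (mon3_le lab) /=; lia.
have := std _ (mem_head _ _).
have := std (mon 0 (f3 * d2) 0, mon 0 0 d3); rewrite !inE eqxx orbT => /(_ isT).
by rewrite !(mon3_le lab) /=; lia.
Qed.

Lemma pairs13_adeg c : c \in pairs13 -> adeg a c.1 = adeg a c.2.
Proof. by move: c; apply: pair_seqP; rewrite !adeg_mon; lia. Qed.

Lemma pairs13_uniq u v :
  adeg a u = adeg a v -> standard pairs13 u -> standard pairs13 v -> u = v.
Proof.
by move=> uv /pairs13_standardP[? ?] /pairs13_standardP[? ?]; apply: standard_first_third.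
Qed.

Lemma pairs13_tails c : c \in pairs13 -> standard pairs13 c.2.
Proof.
have [_ _ [d1p d2p d3p f3p] _] := lab.
move: c; apply: pair_seqP; apply/pairs13_standardP => /=.
  by have [-> _ ->] := mon3E lab 0 d2 0.
by have [-> _ ->] := mon3E lab 0 (f3 * d2) 0.
Qed.

Lemma pairs13_order c : le (mon 0 (f3 * d2) 0) (mon 0 0 d3) ->
  c \in pairs13 -> le c.2 c.1 /\ c.2 <> c.1.
Proof.
have [_ _ [d1p d2p d3p f3p] _] := lab.
by move=> le23; move: c; apply: pair_seqP; split=> //; apply: mon_neq; lia.
Qed.

Lemma pairs13_reduced_groebner_basis : le (mon 0 (f3 * d2) 0) (mon 0 0 d3) ->
  reduced_groebner_basis le (@toric_ideal K 3 a) [seq binomial K c.1 c.2 | c <- pairs13].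
Proof.
move=> le23; have [_ _ [d1p d2p d3p f3p] _] := lab.
apply: pairs_reduced_groebner_basis => //.
- exact: lab_a_gt0 lab.
- exact: pairs13_adeg.
- by move=> c; apply: pairs13_order.
- exact: pairs13_uniq.
- exact: pairs13_tails.
move=> c c' cs; move: c'; apply: pair_seqP; move: c cs; apply: pair_seqP => //= _.
  by rewrite mon_le; lia.
by rewrite mon_le; lia.
Qed.

(** With x2^d2 below x1^d1, the least monomial in x1 and x2 of the larger Betti
    degree is x2^(f3 d2). Comparing it with x3^d3 decides which of the two is a
    leading monomial. *)
Lemma reduced_groebner_basis_circuit_list G g :
    reduced_groebner_basis le (toric_ideal a) G -> g \in G ->
  circuit_list (K := K) i1 i2 i3 d1 d2 d3 f3 g \/
  circuit_list (K := K) i1 i2 i3 d1 d2 d3 f3 (- g).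
Proof.
have [_ _ [d1p d2p d3p f3p] _] := lab; have a_gt0 := lab_a_gt0 lab.
have [[_ _ le_trans le_total] _ _] := le_order.
move=> Gred gG; rewrite /circuit_list.
case/orP: (le_total (mon 0 (f3 * d2) 0) (mon 0 0 d3)) => le23.
  have [c cs ->] := reduced_groebner_basis_mem a_gt0 le_order pairs13_adeg
    (fun c => @pairs13_order c le23) pairs13_uniq pairs13_tails Gred gG.
  rewrite binomialN; move: c cs; apply: pair_seqP; rewrite /binomial !mon3X /=.
    by left; constructor 1; rewrite !expr0 !mulr1 mul1r.
  by right; constructor 3; rewrite !expr0 !mulr1 !mul1r.
have cert t q r : t = mon 0 q r -> le t (mon d1 0 0) -> adeg a t = (d1 * d2 * d3)%N ->
    (q < f3 * d2)%N ->
  exists2 c, c \in pairs12 t & g = binomial K c.1 c.2.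
  move=> tE let1 tdeg tq; apply: reduced_groebner_basis_mem Gred gG => //.
  - by apply: pair_seqP; rewrite /= ?tdeg !adeg_mon; lia.
  - apply: pair_seqP; split=> //=; rewrite ?tE; apply: mon_neq; lia.
  - move=> u v uv /pairs12_standardP[? ?] /pairs12_standardP[? ?].
    exact: standard_first_second.
  apply: pair_seqP; apply/pairs12_standardP => /=; rewrite ?tE.
    by have [-> -> _] := mon3E lab 0 q r.
  by have [-> -> _] := mon3E lab 0 0 d3; rewrite muln_gt0 f3p.
(* For f3 = 1 the three pure powers lie in one fibre, with x3^d3 its least
   monomial. *)
case: (ltngtP 1 f3) f3p => // [f3_gt1 _|f3_1 _].
  have [//||c cs ->] := cert _ d2 0 erefl le21; rewrite ?adeg_mon; try nia.
  rewrite binomialN; move: c cs; apply: pair_seqP; rewrite /binomial !mon3X /=.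
    by left; constructor 1; rewrite !expr0 !mulr1 mul1r.
  by left; constructor 3; rewrite !expr0 !mulr1 !mul1r.
have le31 : le (mon 0 0 d3) (mon d1 0 0).
  by apply: le_trans le21; rewrite -[d2]mul1n f3_1.
have [//||c cs ->] := cert _ 0%N d3 erefl le31; rewrite ?adeg_mon -?f3_1; try nia.
rewrite binomialN; move: c cs; apply: pair_seqP; rewrite /binomial !mon3X /=.
  by left; constructor 2; rewrite -?f3_1 ?mul1n !expr0 !mulr1 mul1r.
by left; constructor 3; rewrite -?f3_1 ?mul1n !expr0 !mulr1 !mul1r.
Qed.

End Order.

End LabelledGroebner.

Definition lex3 (j1 j2 j3 : 'I_3) : rel 'X_{1..3} := fun u v =>
  (u j1 < v j1)%N || (u j1 == v j1) &&
    ((u j2 < v j2)%N || (u j2 == v j2) && (u j3 <= v j3)%N).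

Lemma lex3_monomial_order j1 j2 j3 :
  uniq [:: j1; j2; j3] -> monomial_order (lex3 j1 j2 j3).
Proof.
move=> us; rewrite /lex3; split=> [|m|u v m]; last 2 first.
- by rewrite !mnm0E; lia.
- by rewrite !mnmDE; lia.
split=> [u|u v uv|v u w|u v]; try lia.
apply/mnmP => i; have := mem_three us i; rewrite !inE.
by move=> /or3P[]/eqP ->; lia.
Qed.

Section LabelledUniversalGroebner.
Variables (K : fieldType) (a : 'I_3 -> nat) (i1 i2 i3 : 'I_3) (d1 d2 d3 f3 : nat).
Hypothesis lab : labelled a i1 i2 i3 d1 d2 d3 f3.

Local Notation clist := (@circuit_list K i1 i2 i3 d1 d2 d3 f3).

Lemma universal_groebner_circuit_list (g : {mpoly K[3]}) :
  universal_groebner a g -> clist g \/ clist (- g).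
Proof.
move=> [le [G [le_order Gred gG]]]; have [[_ _ _ le_total] _ _] := le_order.
case/orP: (le_total (mon3 i1 i2 i3 0 d2 0) (mon3 i1 i2 i3 d1 0 0)) => le12.
  exact: (reduced_groebner_basis_circuit_list lab le_order le12 Gred gG).
have le12' : le (mon3 i2 i1 i3 0 d1 0) (mon3 i2 i1 i3 d2 0 0).
  by move: le12; rewrite /mon3 ![(U_(i1) *+ _ + _)%MM]addmC.
have swap p : circuit_list i2 i1 i3 d2 d1 d3 f3 p -> clist p \/ clist (- p).
  case=> ->; [right; constructor 1|left; constructor 3|left; constructor 2] => //.
  by rewrite opprB.
have [|] := reduced_groebner_basis_circuit_list (labelled_swap lab) le_order le12' Gred gG.
  exact: swap.
by move=> /swap; rewrite opprK; tauto.
Qed.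

(** In the lexicographic order in which x3 is the largest variable and x2 the
    smallest, the leading monomials are x1^d1 and x3^d3. *)
Lemma lex_reduced_groebner_basis :
  exists le, monomial_order le /\ reduced_groebner_basis le (@toric_ideal K 3 a)
    [:: 'X_i1 ^+ d1 - 'X_i2 ^+ d2; 'X_i3 ^+ d3 - 'X_i2 ^+ (f3 * d2)].
Proof.
have [us _ [d1p d2p d3p f3p] _] := lab.
have us' : uniq [:: i3; i1; i2] by rewrite -(rot_uniq 1).
exists (lex3 i3 i1 i2); split; first exact: lex3_monomial_order.
have lexE p q r p' q' r' : lex3 i3 i1 i2 (mon3 i1 i2 i3 p q r) (mon3 i1 i2 i3 p' q' r') =
    (r < r')%N || (r == r') && ((p < p')%N || (p == p') && (q <= q')%N).
  by rewrite /lex3; have [-> -> ->] := mon3E lab p q r;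
    have [-> -> ->] := mon3E lab p' q' r'.
have := pairs13_reduced_groebner_basis K lab (lex3_monomial_order us').
rewrite /= /binomial !mon3X !expr0 !mulr1 !mul1r.
by apply; rewrite lexE; lia.
Qed.
End LabelledUniversalGroebner.

Lemma circuit_list_universal_groebner (K : fieldType) a i1 i2 i3 d1 d2 d3 f3
    (p : {mpoly K[3]}) : labelled a i1 i2 i3 d1 d2 d3 f3 ->
  circuit_list i1 i2 i3 d1 d2 d3 f3 p ->
  universal_groebner a p \/ universal_groebner a (- p).
Proof.
move=> lab; have [le [le_order Gred]] := lex_reduced_groebner_basis K lab.
have [le' [le'_order G'red]] := lex_reduced_groebner_basis K (labelled_swap lab).
case=> ->.
- left; exists le; eexists; split; [exact: le_order|exact: Gred|].
  by rewrite !inE eqxx.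
- right; exists le'; eexists; split; [exact: le'_order|exact: G'red|].
  by rewrite !inE opprB eqxx orbT.
right; exists le; eexists; split; [exact: le_order|exact: Gred|].
by rewrite !inE opprB eqxx orbT.
Qed.

(** * Minimal generating sets and free arrangements *)

Section Generated.
Variables (n : nat) (a : 'I_n -> nat).
Implicit Types (J : {set 'I_n}).

Lemma generatedD J s t :
  generated a J s -> generated a J t -> generated a J (s + t).
Proof.
move=> [u ->] [v ->]; exists (fun i => u i + v i)%N.
by rewrite -big_split; apply: eq_bigr => i _; rewrite mulnDl.
Qed.

Lemma generatedM J k s : generated a J s -> generated a J (k * s).
Proof.
move=> [u ->]; exists (fun i => k * u i)%N.
by rewrite big_distrr; apply: eq_bigr => i _ /=; rewrite mulnA.
Qed.

Lemma generated_gen J i : i \in J -> generated a J (a i).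
Proof.
move=> iJ; exists (fun j => (j == i) : nat).
rewrite (bigD1 i) //= eqxx mul1n big1 ?addn0 // => j /andP[_ /negPf ->].
exact: mul0n.
Qed.

Lemma generated_sub J J' s :
  (forall i, i \in J -> generated a J' (a i)) -> generated a J s -> generated a J' s.
Proof.
move=> sub [u ->]; elim/big_ind: _ => [|s1 s2|i /sub]; last exact: generatedM.
  by exists (fun=> 0%N); rewrite big1.
exact: generatedD.
Qed.

(** A representation of a number below a_i cannot use a_i. *)
Lemma generated_lt i s : (s < a i)%N -> generated a [set: 'I_n] s ->
  generated a [set~ i] s.
Proof.
move=> lt_si [u sE]; exists u; rewrite sE (bigD1 i) ?inE //=.
have -> : u i = 0%N.
  case: (posnP (u i)) => // ui0; move: lt_si; rewrite sE (bigD1 i) ?inE //=; nia.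
by rewrite mul0n; apply: eq_bigl => j; rewrite !inE.
Qed.

Lemma generated_dvd J s g :
  (forall i, (g %| a i)%N) -> generated a J s -> (g %| s)%N.
Proof. by move=> ga [u ->]; apply: dvdn_sum => i _; apply: dvdn_mull. Qed.

End Generated.

Section MinimalGenerators.
Variables (n : nat) (a : 'I_n -> nat) (S : nat -> Prop).
Hypothesis Sa : minimal_generators S a.

Lemma minimal_irredundant i : ~ generated a [set~ i] (a i).
Proof.
have [_ SE /(_ [set~ i]) min] := Sa => ai; apply: min.
  by rewrite properEneq subsetT andbT; apply/eqP => /setP/(_ i); rewrite !inE eqxx.
move=> s; rewrite SE; split; apply: generated_sub => j _; last first.
  by apply: generated_gen; rewrite inE.
case: (eqVneq j i) => [->|ji]; first exact: ai.
by apply: generated_gen; rewrite !inE.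
Qed.

Lemma minimal_gt0 i : (0 < a i)%N.
Proof.
case: (posnP (a i)) => // ai0; case: (@minimal_irredundant i).
by rewrite ai0; exists (fun=> 0%N); rewrite big1.
Qed.

Lemma minimal_gcd g : numerical_semigroup S -> (forall i, (g %| a i)%N) -> g = 1%N.
Proof.
move=> [m [b [_ gcdb SE]]] ga; have [_ SEa _] := Sa.
apply/eqP; rewrite -dvdn1 -gcdb; apply/dvdn_biggcdP => j _.
by apply: (generated_dvd ga); apply/SEa/SE; apply: generated_gen; rewrite inE.
Qed.

End MinimalGenerators.

(** A minimal generator is not a sum of two positive elements of the semigroup,
    so it occurs in every generating family. *)
Lemma minimal_generators_sub S n m (a : 'I_n -> nat) (b : 'I_m -> nat) :
    minimal_generators S a -> minimal_generators S b ->
  forall i, exists j, a i = b j.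
Proof.
move=> Sa Sb i; have [_ SEa _] := Sa; have [_ SEb _] := Sb.
have ai0 := minimal_gt0 Sa i.
have /SEb[u aiE] : S (a i) by apply/SEa; apply: generated_gen; rewrite inE.
have [j uj] : exists j, (0 < u j)%N.
  apply: NNPP => no; move: ai0; rewrite aiE big1 // => j _.
  by case: (posnP (u j)) => [->//|uj]; case: no; exists j.
exists j; pose r := (\sum_(k in [set: 'I_m]) (u k - (k == j)) * b k)%N.
have aiE' : a i = (b j + r)%N.
  rewrite aiE /r (bigD1 j) ?inE //= [in RHS](bigD1 j) ?inE //= eqxx.
  rewrite addnA -[X in (X + _ + _)%N]mul1n -mulnDl subnKC //; congr addn.
  by apply: eq_bigr => k /andP[_ /negPf ->]; rewrite subn0.
case: (posnP r) => [r0|r0]; first by rewrite aiE' r0 addn0.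
have bj0 := minimal_gt0 Sb j; case: (minimal_irredundant Sa (i := i)).
rewrite aiE'; apply: generatedD; apply: generated_lt; try lia; apply/SEa/SEb.
  by apply: generated_gen; rewrite inE.
by exists (fun k => u k - (k == j))%N.
Qed.

Lemma minimal_generators_perm S n (a : 'I_n -> nat) (f : 'I_n -> 'I_n) :
  injective f -> minimal_generators S a -> minimal_generators S (a \o f).
Proof.
move=> injf [inja SE min].
have [g gK fK] : bijective f by apply: injF_bij.
have genE J s : generated (a \o f) J s <-> generated a (f @: J) s.
  split=> -[u ->].
    exists (u \o g); rewrite big_imset /=; last by move=> i j _ _ /injf.
    by apply: eq_bigr => i _; rewrite gK.
  by exists (u \o f); rewrite big_imset //= => i j _ _ /injf.
have fT : f @: [set: 'I_n] = [set: 'I_n].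
  by apply/setP => i; rewrite !inE -[i]fK imset_f ?inE.
split=> [|s|J ltJ SJ]; first exact: inj_comp.
  by rewrite genE fT.
apply: (min (f @: J)) => [|s]; last by rewrite SJ genE.
by rewrite properEcard subsetT cardsT -[#|'I_n|](cardsT) -[in X in (_ < X)%N]fT
  !card_imset // proper_card.
Qed.

Lemma generated_three (a : 'I_3 -> nat) i1 i2 i3 s : uniq [:: i1; i2; i3] ->
  generated a [set~ i1] s <-> exists p q, s = (p * a i2 + q * a i3)%N.
Proof.
move=> us; have /and3P[n1 n2 _] := us; move: n1 n2; rewrite !inE negb_or.
move=> /andP[n12 n13] n23.
split=> [[u ->]|[p [q ->]]].
  exists (u i2), (u i3); rewrite (perm_big _ (perm_three us)) /= !big_cons big_nil.
  by rewrite !inE eqxx [i2 == i1]eq_sym n12 [i3 == i1]eq_sym n13 /= addn0.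
by apply: generatedD; apply: generatedM; apply: generated_gen; rewrite !inE eq_sym.
Qed.

Lemma biggcd_three (a : 'I_3 -> nat) i1 i2 i3 : uniq [:: i1; i2; i3] ->
  \big[gcdn/0%N]_(j | j != i1) a j = gcdn (a i2) (a i3).
Proof.
move=> us; have /and3P[n1 n2 _] := us; move: n1 n2; rewrite !inE negb_or.
move=> /andP[n12 n13] n23.
rewrite (perm_big _ (perm_three us)) /= !big_cons big_nil.
by rewrite eqxx [i2 == i1]eq_sym n12 [i3 == i1]eq_sym n13 /= gcdn0.
Qed.

(** In an arrangement of three generators the condition at the second one always
    holds, since lcm(b, c) is a multiple of c, and the condition at the first one
    depends only on which generator comes first. *)
Definition free_first (a : 'I_3 -> nat) i :=
  generated a [set~ i] (lcmn (a i) (\big[gcdn/0%N]_(j | j != i) a j)).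

Lemma set_gt0_three : [set j : 'I_3 | ((ord0 : 'I_3) < j)%N] = [set~ ord0].
Proof. by apply/setP => j; rewrite !inE lt0n. Qed.

Lemma free_forP (b : 'I_3 -> nat) : free_for b <-> free_first b ord0.
Proof.
have E : \big[gcdn/0%N]_(j : 'I_3 | ((ord0 : 'I_3) < j)%N) b j =
    \big[gcdn/0%N]_(j | j != ord0) b j.
  by apply: eq_bigl => j; rewrite lt0n.
split=> [/(_ ord0 isT)|free i lt_i]; first by rewrite set_gt0_three E.
case: (posnP i) => [i0|i_gt0].
  by have -> : i = ord0; [apply: val_inj | rewrite set_gt0_three E].
have -> : i = Ordinal (isT : 1 < 3)%N by apply: val_inj => /=; lia.
have maxE (j : 'I_3) : (1 < j)%N = (j == ord_max).
  by rewrite -val_eqE /=; have := ltn_ord j; lia.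
rewrite (eq_bigl (pred1 ord_max)) => [|j]; last exact: maxE.
rewrite big_pred1_eq.
have /dvdnP[q ->] := dvdn_lcmr (b (Ordinal (isT : 1 < 3)%N)) (b ord_max).
by apply: generatedM; apply: generated_gen; rewrite inE maxE.
Qed.

(** All minimal generating families are permutations of each other. *)
Lemma universally_freeP S (a : 'I_3 -> nat) : minimal_generators S a ->
  universally_free S <-> (forall i, free_first a i).
Proof.
move=> Sa; have [inja _ _] := Sa.
have firstE (f : 'I_3 -> 'I_3) : injective f ->
    free_first (a \o f) ord0 <-> free_first a (f ord0).
  move=> injf; pose o1 := Ordinal (isT : 1 < 3)%N.
  have us : uniq [:: ord0; o1; ord_max] by [].
  have usf : uniq [:: f ord0; f o1; f ord_max].
    by rewrite -[[:: f _; _; _]]/(map f [:: ord0; o1; ord_max]) map_inj_uniq.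
  rewrite /free_first (biggcd_three _ us) (biggcd_three _ usf).
  by rewrite (generated_three _ _ us) (generated_three _ _ usf).
split=> [free i|free n b Sb].
  have injt : injective (tperm ord0 i) by exact: perm_inj.
  rewrite -[i](tpermL ord0); apply/(firstE _ injt)/free_forP.
  exact: free (minimal_generators_perm injt Sa).
have [injb _ _] := Sb.
have leq_size k l (c : 'I_k -> nat) (d : 'I_l -> nat) : injective c ->
    (forall i, exists j, c i = d j) -> (k <= l)%N.
  move=> injc /fin_all_exists[h ch]; rewrite -[k]card_ord -[l]card_ord.
  by apply: (leq_card h) => x y hxy; apply: injc; rewrite !ch hxy.
have subb := minimal_generators_sub Sb Sa.
have n3 : n = 3%N.
  apply/eqP; rewrite eqn_leq (leq_size _ _ _ _ injb subb).
  exact: (leq_size _ _ _ _ inja (minimal_generators_sub Sa Sb)).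
move: b Sb injb subb; rewrite n3 => b Sb injb /fin_all_exists[f bf].
have injf : injective f by move=> x y fxy; apply: injb; rewrite !bf fxy.
have bE : b =1 a \o f by [].
apply/free_forP; have := free (f ord0); rewrite -(firstE f injf) /free_first.
rewrite -bE (eq_bigr b) // => -[u ->]; exists u.
by apply: eq_bigr => i _; rewrite bE.
Qed.

(** * Arithmetic of three generators *)

(** If c3 a3 is a common multiple of a1 and a2, minimality makes c3 the quotient
    of a1 by gcd(a1, a3) and of a2 by gcd(a2, a3). *)
Lemma critical_common_multiple a1 a2 a3 c3 :
    (0 < a1)%N -> (0 < a2)%N -> (0 < a3)%N ->
    coprime (gcdn a1 a3) (gcdn a2 a3) -> (0 < c3)%N ->
    (a1 %| c3 * a3)%N -> (a2 %| c3 * a3)%N ->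
    (forall c p q, (0 < c)%N -> (c * a3 = p * a1 + q * a2)%N -> (c3 <= c)%N) ->
  exists d1 d2 d3 f3, [/\ a1 = d2 * d3, a2 = d1 * d3 & a3 = f3 * d1 * d2]%N.
Proof.
move=> a1p a2p a3p cop c3p dv1 dv2 cmin.
have quot x : (0 < x)%N -> (x %| c3 * a3)%N ->
    (forall c p, (0 < c)%N -> (c * a3 = p * x)%N -> (c3 <= c)%N) ->
    x = (gcdn x a3 * c3)%N.
  move=> xp xdv xmin; have gp : (0 < gcdn x a3)%N by rewrite gcdn_gt0 xp.
  have /dvdnP[y yE] := dvdn_gcdl x a3; have /dvdnP[z zE] := dvdn_gcdr x a3.
  set g := gcdn x a3 in gp yE zE *.
  have yz : coprime y z.
    rewrite /coprime -(eqn_pmul2r gp) muln_gcdl -yE -zE mul1n; exact: eqxx.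
  have le_c3y : (c3 <= y)%N by apply: (xmin y z); nia.
  have : (y %| c3)%N.
    rewrite -(Gauss_dvdl _ yz) -(dvdn_pmul2r gp) -yE -mulnA -zE; exact: xdv.
  by move=> /(dvdn_leq c3p) le_yc3; rewrite {1}yE; nia.
have a1E : a1 = (gcdn a1 a3 * c3)%N.
  by apply: quot => // c p cp E; apply: (cmin c p 0%N cp); rewrite E addn0.
have a2E : a2 = (gcdn a2 a3 * c3)%N.
  by apply: quot => // c p cp E; apply: (cmin c 0%N p cp); rewrite E.
have /dvdnP[f fE] : (gcdn a1 a3 * gcdn a2 a3 %| a3)%N.
  by rewrite Gauss_dvd // !dvdn_gcdr.
exists (gcdn a2 a3), (gcdn a1 a3), c3, f; split=> //.
by rewrite {1}fE; lia.
Qed.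

(** The least of three positive integers, each in the semigroup of the other two,
    equals one of these, and coprime equal integers are 1. *)
Lemma mutually_generated f1 f2 f3 :
    (0 < f1)%N -> (0 < f2)%N -> (0 < f3)%N ->
    coprime f1 f2 -> coprime f1 f3 -> coprime f2 f3 ->
    (exists p q, f1 = p * f2 + q * f3)%N -> (exists p q, f2 = p * f1 + q * f3)%N ->
    (exists p q, f3 = p * f1 + q * f2)%N ->
  [\/ f1 = 1 /\ f2 = 1, f1 = 1 /\ f3 = 1 | f2 = 1 /\ f3 = 1]%N.
Proof.
move=> p1 p2 p3 c12 c13 c23.
have eq1 x y : coprime x y -> x = y -> x = 1%N /\ y = 1%N.
  by move=> xy E; move: xy; rewrite E /coprime gcdnn => /eqP.
have least x y z p q : (0 < x)%N -> (x <= y)%N -> (x <= z)%N -> x = (p * y + q * z)%N ->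
    x = y \/ x = z.
  by move=> x0 xy xz E; case: p E => [|p] E; [right; case: q E => [|q] E; nia|left; nia].
move=> [p [q E1]] [p' [q' E2]] [p'' [q'' E3]].
have [l12|l21] := leqP f1 f2; have [l13|l31] := leqP f1 f3.
- case: (least _ _ _ _ _ p1 l12 l13 E1) => /eq1 E.
    by constructor 1; apply: E.
  by constructor 2; apply: E.
- case: (least _ _ _ _ _ p3 (ltnW l31) (leq_trans (ltnW l31) l12) E3) => E; first lia.
  by constructor 3; apply: eq1.
- case: (least _ _ _ _ _ p2 (ltnW l21) (leq_trans (ltnW l21) l13) E2) => E; first lia.
  by constructor 3; apply: eq1.
have [l23|l32] := leqP f2 f3.
  case: (least _ _ _ _ _ p2 (ltnW l21) l23 E2) => E; first lia.
  by constructor 3; apply: eq1.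
case: (least _ _ _ _ _ p3 (ltnW l31) (ltnW l32) E3) => E; first lia.
by constructor 3; apply: eq1.
Qed.

(** Since lcm(a1, gcd(a2, a3)) = a1 d1 with d1 = gcd(a2, a3), dividing a
    representation of it by d1 d2 d3 expresses the cofactor f1 of a1. *)
Lemma free_cofactor d1 d2 d3 f1 f2 f3 p q :
    (0 < d1)%N -> (0 < d2)%N -> (0 < d3)%N ->
    coprime d2 (d3 * f2) -> coprime d3 (d2 * f3) ->
    (d2 * d3 * f1 * d1 = p * (d1 * d3 * f2) + q * (d1 * d2 * f3))%N ->
  (exists p q, f1 = p * f2 + q * f3)%N.
Proof.
move=> d1p d2p d3p c2 c3 E.
have E' : (d2 * d3 * f1 = p * (d3 * f2) + q * (d2 * f3))%N.
  by apply/eqP; rewrite -(eqn_pmul2r d1p); apply/eqP; rewrite E; lia.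
have /dvdnP[p' pE] : (d2 %| p)%N.
  rewrite -(Gauss_dvdl _ c2) -(dvdn_addl _ (n := q * (d2 * f3))) -?E'.
    by rewrite -mulnA dvdn_mulr.
  by rewrite mulnCA dvdn_mulr.
have /dvdnP[q' qE] : (d3 %| q)%N.
  rewrite -(Gauss_dvdl _ c3) -(dvdn_addr _ (m := p * (d3 * f2))) -?E'.
    by rewrite -mulnA dvdn_mull // dvdn_mulr.
  by rewrite mulnCA dvdn_mulr.
exists p', q'; apply/eqP.
have dp : (0 < d2 * d3)%N by rewrite muln_gt0 d2p.
by rewrite -(eqn_pmul2l dp) E' pE qE; apply/eqP; lia.
Qed.

(** * The equivalence *)

Section Equivalence.
Variables (K : fieldType) (S : nat -> Prop) (a : 'I_3 -> nat).
Hypotheses (HS : numerical_semigroup S) (Ha : minimal_generators S a).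

Let a_gt0 : forall i, (0 < a i)%N := minimal_gt0 Ha.

Lemma gcd_three i1 i2 i3 g : uniq [:: i1; i2; i3] ->
  (g %| a i1)%N -> (g %| a i2)%N -> (g %| a i3)%N -> g = 1%N.
Proof.
move=> us g1 g2 g3; apply: (minimal_gcd Ha HS) => i.
by have := mem_three us i; rewrite !inE => /or3P[] /eqP ->.
Qed.

Lemma labelled_of_generators i1 i2 i3 d1 d2 d3 f3 : uniq [:: i1; i2; i3] ->
    a i1 = (d2 * d3)%N -> a i2 = (d1 * d3)%N -> a i3 = (f3 * d1 * d2)%N ->
  labelled a i1 i2 i3 d1 d2 d3 f3.
Proof.
move=> us a1 a2 a3; have [[p1 p2] p3] := (a_gt0 i1, a_gt0 i2, a_gt0 i3).
have cop x y : (gcdn x y %| a i1)%N -> (gcdn x y %| a i2)%N ->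
    (gcdn x y %| a i3)%N -> coprime x y.
  by move=> g1 g2 g3; apply/eqP; apply: gcd_three us g1 g2 g3.
split=> //.
  move: p1 p2 p3; rewrite a1 a2 a3 !muln_gt0 => /andP[-> ->] /andP[-> _].
  by move=> /andP[/andP[-> _] _].
split; apply: cop; rewrite ?a1 ?a2 ?a3.
- exact/dvdn_mulr/dvdn_gcdr.
- exact/dvdn_mulr/dvdn_gcdl.
- exact/dvdn_mull/dvdn_gcdr.
- exact/dvdn_mull/dvdn_gcdr.
- exact/dvdn_mull/dvdn_gcdr.
- exact/dvdn_mulr/dvdn_mull/dvdn_gcdl.
- exact/dvdn_mull/dvdn_gcdr.
- exact/dvdn_mull/dvdn_gcdr.
- exact/dvdn_mull/dvdn_gcdl.
- exact/dvdn_mull/dvdn_gcdr.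
- exact/dvdn_mull/dvdn_gcdr.
exact/dvdn_mulr/dvdn_mulr/dvdn_gcdl.
Qed.

Definition has_form := exists i1 i2 i3 d1 d2 d3 f3, labelled a i1 i2 i3 d1 d2 d3 f3.

Lemma labelled_betti_form i1 i2 i3 d1 d2 d3 f3 :
  labelled a i1 i2 i3 d1 d2 d3 f3 -> betti_form K a d1 d2 d3 f3.
Proof.
move=> lab; have [us [a1 a2 a3] pos _] := lab; split=> //; last first.
  exact (betti_labelled K lab).
move=> x; rewrite !inE -a1 -a2 -a3; apply/codomP/idP => [[i ->]|].
  by have := mem_three us i; rewrite !inE => /or3P[] /eqP ->; rewrite eqxx ?orbT.
by move=> /or3P[] /eqP ->; [exists i1|exists i2|exists i3].
Qed.

Lemma betti_form_labelled i1 i2 i3 d1 d2 d3 f3 : betti_form K a d1 d2 d3 f3 ->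
    a i1 = (d2 * d3)%N -> a i2 = (d1 * d3)%N -> a i3 = (f3 * d1 * d2)%N ->
  labelled a i1 i2 i3 d1 d2 d3 f3.
Proof.
move=> [_ cod _] a1 a2 a3; apply: labelled_of_generators => //.
have [inja _ _] := Ha; rewrite -(map_inj_uniq inja) [map a _]/= a1 a2 a3.
rewrite -(eq_uniq _ cod); first by rewrite map_inj_uniq ?enum_uniq.
by rewrite size_codom card_ord.
Qed.

Lemma betti_form_has_form d1 d2 d3 f3 : betti_form K a d1 d2 d3 f3 ->
  exists i1 i2 i3, labelled a i1 i2 i3 d1 d2 d3 f3.
Proof.
move=> bf; have [_ cod _] := bf.
have mem_cod x : x \in [:: d2 * d3; d1 * d3; f3 * d1 * d2]%N -> exists i, a i = x.
  by rewrite -cod => /codomP[i ->]; exists i.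
have [i1 a1] := mem_cod _ (mem_head _ _).
have [|i2 a2] := mem_cod (d1 * d3)%N; first by rewrite !inE eqxx orbT.
have [|i3 a3] := mem_cod (f3 * d1 * d2)%N; first by rewrite !inE eqxx !orbT.
by exists i1, i2, i3; apply: betti_form_labelled bf a1 a2 a3.
Qed.

Lemma has_formP : has_form <-> exists d1 d2 d3 f3, betti_form K a d1 d2 d3 f3.
Proof.
split=> [[i1 [i2 [i3 [d1 [d2 [d3 [f3 /labelled_betti_form bf]]]]]]]|].
  by exists d1, d2, d3, f3.
move=> [d1 [d2 [d3 [f3 /betti_form_has_form[i1 [i2 [i3 lab]]]]]]].
by exists i1, i2, i3, d1, d2, d3, f3.
Qed.

Lemma labelled_free_first i1 i2 i3 d1 d2 d3 f3 :
  labelled a i1 i2 i3 d1 d2 d3 f3 -> free_first a i1.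
Proof.
move=> lab; have [us [a1 a2 a3] [d1p d2p d3p f3p] [c12 c13 c23 cf]] := lab.
rewrite /free_first (biggcd_three _ us) a1 a2 a3.
have -> : gcdn (d1 * d3) (f3 * d1 * d2) = d1.
  rewrite [(f3 * d1)%N]mulnC -mulnA -muln_gcdr.
  suff /eqP -> : coprime d3 (f3 * d2) by rewrite muln1.
  by rewrite coprimeMr coprime_sym cf coprime_sym c23.
apply/(generated_three _ _ us); exists d2, 0%N; rewrite mul0n addn0 a2.
have : coprime (d2 * d3) d1 by rewrite coprimeMl [coprime d2 _]coprime_sym c12 coprime_sym.
by rewrite /lcmn => /eqP ->; rewrite divn1; lia.
Qed.

Lemma labelled_free_third i1 i2 i3 d1 d2 d3 f3 :
  labelled a i1 i2 i3 d1 d2 d3 f3 -> free_first a i3.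
Proof.
move=> lab; have [us [a1 a2 a3] [d1p d2p d3p f3p] [c12 c13 c23 cf]] := lab.
have us3 : uniq [:: i3; i1; i2] by rewrite -(rot_uniq 1).
rewrite /free_first (biggcd_three _ us3) a1 a2 a3.
have -> : gcdn (d2 * d3) (d1 * d3) = d3.
  rewrite -muln_gcdl.
  by have /eqP -> : coprime d2 d1; rewrite 1?coprime_sym // mul1n.
apply/(generated_three _ _ us3); exists (f3 * d1)%N, 0%N; rewrite mul0n addn0 a1.
have : coprime (f3 * d1 * d2) d3 by rewrite !coprimeMl cf c13.
by rewrite /lcmn => /eqP ->; rewrite divn1; lia.
Qed.

Lemma has_form_free : has_form -> forall i, free_first a i.
Proof.
move=> [i1 [i2 [i3 [d1 [d2 [d3 [f3 lab]]]]]]] i; have [us _ _ _] := lab.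
have := mem_three us i; rewrite !inE => /or3P[] /eqP ->.
- exact: labelled_free_first lab.
- exact: labelled_free_first (labelled_swap lab).
exact: labelled_free_third lab.
Qed.

(** With d_i the gcd of the two generators other than a_i, one has
    a_i = d_j d_k f_i; freeness puts each f_i in the semigroup of the other two,
    which forces two of them to be 1. *)
Lemma free_has_form : (forall i, free_first a i) -> has_form.
Proof.
move=> free; pose i1 : 'I_3 := ord0; pose i2 := Ordinal (isT : 1 < 3)%N.
pose i3 : 'I_3 := ord_max.
have us1 : uniq [:: i1; i2; i3] by [].
have us2 : uniq [:: i2; i1; i3] by [].
have us3 : uniq [:: i3; i1; i2] by [].
have := free i3; have := free i2; have := free i1; rewrite /free_first.
rewrite (biggcd_three _ us1) (biggcd_three _ us2) (biggcd_three _ us3).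
move=> /(generated_three _ _ us1) F1 /(generated_three _ _ us2) F2.
move=> /(generated_three _ _ us3) F3.
have [[p1 p2] p3] := (a_gt0 i1, a_gt0 i2, a_gt0 i3).
have gcd1 := gcd_three us1.
pose d1 := gcdn (a i2) (a i3); pose d2 := gcdn (a i1) (a i3).
pose d3 := gcdn (a i1) (a i2).
have d1p : (0 < d1)%N by rewrite gcdn_gt0 p2.
have d2p : (0 < d2)%N by rewrite gcdn_gt0 p1.
have d3p : (0 < d3)%N by rewrite gcdn_gt0 p1.
have c23 : coprime d2 d3.
  apply/eqP/gcd1; [apply: dvdn_trans (dvdn_gcdl _ _) (dvdn_gcdl _ _)
    |apply: dvdn_trans (dvdn_gcdr _ _) (dvdn_gcdr _ _)
    |apply: dvdn_trans (dvdn_gcdl _ _) (dvdn_gcdr _ _)].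
have c13 : coprime d1 d3.
  apply/eqP/gcd1; [apply: dvdn_trans (dvdn_gcdr _ _) (dvdn_gcdl _ _)
    |apply: dvdn_trans (dvdn_gcdl _ _) (dvdn_gcdl _ _)
    |apply: dvdn_trans (dvdn_gcdl _ _) (dvdn_gcdr _ _)].
have c12 : coprime d1 d2.
  apply/eqP/gcd1; [apply: dvdn_trans (dvdn_gcdr _ _) (dvdn_gcdl _ _)
    |apply: dvdn_trans (dvdn_gcdl _ _) (dvdn_gcdl _ _)
    |apply: dvdn_trans (dvdn_gcdl _ _) (dvdn_gcdr _ _)].
have /dvdnP[f1 a1] : (d2 * d3 %| a i1)%N by rewrite Gauss_dvd // !dvdn_gcdl.
have /dvdnP[f2 a2] : (d1 * d3 %| a i2)%N by rewrite Gauss_dvd // dvdn_gcdl dvdn_gcdr.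
have /dvdnP[f3 a3] : (d1 * d2 %| a i3)%N by rewrite Gauss_dvd // !dvdn_gcdr.
have lcmE x g : coprime x g -> lcmn x g = (x * g)%N.
  by rewrite /lcmn => /eqP ->; rewrite divn1.
(* The gcd of each pair of generators is d1, d2 or d3, so the remaining factors
   of the two generators are coprime. *)
have cop_quot x y g : (0 < g)%N -> gcdn (x * g) (y * g) = g -> coprime x y.
  by move=> gp; rewrite -muln_gcdl => E; rewrite /coprime -(eqn_pmul2r gp) E mul1n.
have c1 : coprime (f2 * d3) (f3 * d2).
  by apply: (cop_quot _ _ d1 d1p); rewrite -!mulnA ![(_ * d1)%N]mulnC -a2 -a3.
have c2 : coprime (f1 * d3) (f3 * d1).
  by apply: (cop_quot _ _ d2 d2p); rewrite -!mulnA [(d3 * d2)%N]mulnC -a1 -a3.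
have c3 : coprime (f1 * d2) (f2 * d1).
  by apply: (cop_quot _ _ d3 d3p); rewrite -!mulnA -a1 -a2.
move: c1 c2 c3; rewrite !coprimeMl !coprimeMr.
move=> /andP[/andP[f23 cf22] /andP[cf33 _]] /andP[/andP[f13 cf11] /andP[cf33' _]].
move=> /andP[/andP[f12 cf11'] /andP[cf22' _]].
have x1 : (exists p q, f1 = p * f2 + q * f3)%N.
  case: F1 => p [q]; rewrite lcmE => [E|]; last first.
    by rewrite a1 !coprimeMl cf11 coprime_sym c12 coprime_sym c13.
  apply: (@free_cofactor d1 d2 d3 f1 f2 f3 p q) => //.
  - by rewrite coprimeMr c23 coprime_sym.
  - by rewrite coprimeMr coprime_sym c23.
  - by move: E; rewrite -/d1 a1 a2 a3; lia.
have x2 : (exists p q, f2 = p * f1 + q * f3)%N.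
  case: F2 => p [q]; rewrite lcmE => [E|]; last first.
    by rewrite a2 !coprimeMl cf22 c12 coprime_sym c23.
  apply: (@free_cofactor d2 d1 d3 f2 f1 f3 p q) => //.
  - by rewrite coprimeMr c13 coprime_sym.
  - by rewrite coprimeMr coprime_sym c13.
  - by move: E; rewrite -/d2 a1 a2 a3; lia.
have x3 : (exists p q, f3 = p * f1 + q * f2)%N.
  case: F3 => p [q]; rewrite lcmE => [E|]; last first.
    by rewrite a3 !coprimeMl [coprime f3 d3]coprime_sym cf33 c13 c23.
  apply: (@free_cofactor d3 d1 d2 f3 f1 f2 p q) => //.
  - by rewrite coprimeMr c12 coprime_sym.
  - by rewrite coprimeMr coprime_sym c12.
  - by move: E; rewrite -/d3 a1 a2 a3; lia.
have [f1p f2p f3p] : [/\ 0 < f1, 0 < f2 & 0 < f3]%N.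
  by move: p1 p2 p3; rewrite a1 a2 a3 !muln_gt0 => /andP[-> _] /andP[-> _] /andP[-> _].
have [[e1 e2]|[e1 e3]|[e2 e3]] := mutually_generated f1p f2p f3p f12 f13 f23 x1 x2 x3.
- exists i1, i2, i3, d1, d2, d3, f3; apply: labelled_of_generators => //.
  + by rewrite a1 e1 mul1n.
  + by rewrite a2 e2 mul1n.
  + by rewrite a3 mulnA.
- exists i1, i3, i2, d1, d3, d2, f2; apply: labelled_of_generators => //.
  + by rewrite a1 e1 mul1n mulnC.
  + by rewrite a3 e3 mul1n.
  + by rewrite a2 mulnA.
exists i2, i3, i1, d2, d3, d1, f1; apply: labelled_of_generators => //.
+ by rewrite a2 e2 mul1n mulnC.
+ by rewrite a3 e3 mul1n mulnC.
by rewrite a1 mulnA.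
Qed.

Lemma critical_exponent_all i : exists c, critical_exponent a i c.
Proof.
pose j : 'I_3 := if i == ord0 then ord_max else ord0.
have ji : j != i by rewrite /j; case: (eqVneq i ord0) => [->|]; rewrite // eq_sym.
apply: (@critical_exponent_exists _ _ _ (a j)) => //; rewrite mulnC.
by apply: generatedM; apply: generated_gen; rewrite !inE.
Qed.

(** The degrees c_i a_i are Betti degrees; when they are totally ordered by
    divisibility, one of them is a multiple of all three generators. *)
Lemma betti_divisible_has_form : betti_divisible K a -> has_form.
Proof.
move=> div; have /fin_all_exists[c crit] := critical_exponent_all.
have tot i j : (c i * a i %| c j * a j)%N \/ (c j * a j %| c i * a i)%N.
  by apply: div; apply: critical_betti.
have finish i1 i2 i3 : uniq [:: i1; i2; i3] -> (c i1 * a i1 %| c i3 * a i3)%N ->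
    (c i2 * a i2 %| c i3 * a i3)%N -> has_form.
  move=> us dv1 dv2; have [c3p _ c3min] := crit i3.
  have us3 : uniq [:: i3; i1; i2] by rewrite -(rot_uniq 1).
  have [//|//|//||//||||d1 [d2 [d3 [f3 [a1 a2 a3]]]]] :=
    @critical_common_multiple (a i1) (a i2) (a i3) (c i3).
  - apply/eqP/(gcd_three us).
    + exact: dvdn_trans (dvdn_gcdl _ _) (dvdn_gcdl _ _).
    + exact: dvdn_trans (dvdn_gcdr _ _) (dvdn_gcdl _ _).
    + exact: dvdn_trans (dvdn_gcdl _ _) (dvdn_gcdr _ _).
  - exact: dvdn_trans (dvdn_mull _ (dvdnn _)) dv1.
  - exact: dvdn_trans (dvdn_mull _ (dvdnn _)) dv2.
  - move=> c' p q c'p E; apply: c3min => //.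
    by apply/(generated_three _ _ us3); exists p, q.
  by exists i1, i2, i3, d1, d2, d3, f3; apply: labelled_of_generators.
pose i1 : 'I_3 := ord0; pose i2 := Ordinal (isT : 1 < 3)%N.
pose i3 : 'I_3 := ord_max.
have [D12|D21] := tot i1 i2; have [D23|D32] := tot i2 i3.
- exact: (finish i1 i2 i3 isT (dvdn_trans D12 D23) D23).
- exact: (finish i1 i3 i2 isT D12 D32).
- have [D13|D31] := tot i1 i3; first exact: (finish i1 i2 i3 isT D13 D23).
  exact: (finish i2 i3 i1 isT D21 D31).
exact: (finish i2 i3 i1 isT D21 (dvdn_trans D32 D21)).
Qed.

Lemma has_form_betti_divisible : has_form -> betti_divisible K a.
Proof.
move=> [i1 [i2 [i3 [d1 [d2 [d3 [f3 lab]]]]]]] d e.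
move=> /(betti_labelled K lab) dE /(betti_labelled K lab) eE.
have dv : (d1 * d2 * d3 %| f3 * d1 * d2 * d3)%N by rewrite -!mulnA dvdn_mull.
by case: dE eE => -> [] ->; [left|left|right|left].
Qed.

End Equivalence.

Theorem theorem4p2 (K : fieldType) (S : nat -> Prop) (a : 'I_3 -> nat)
    (HS : numerical_semigroup S) (Ha : minimal_generators S a) :
  (* equivalence of (a), (b), (c) *)
  [/\ universally_free S <-> betti_divisible K a
    , betti_divisible K a <-> (exists d1 d2 d3 f3, betti_form K a d1 d2 d3 f3)
    (* the "in particular" clause of (c) *)
    , (forall d1 d2 d3 f3, betti_form K a d1 d2 d3 f3 ->
        [/\ coprime d1 d2, coprime d1 d3, coprime d2 d3 & coprime f3 d3])
    (* the "moreover" clause *)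
    & forall d1 d2 d3 f3 (i1 i2 i3 : 'I_3), betti_form K a d1 d2 d3 f3 ->
        a i1 = (d2 * d3)%N -> a i2 = (d1 * d3)%N -> a i3 = (f3 * d1 * d2)%N ->
      let x1 : {mpoly K[3]} := 'X_i1 in
      let x2 : {mpoly K[3]} := 'X_i2 in
      let x3 : {mpoly K[3]} := 'X_i3 in
      [/\ same_set_up_to_sign (universal_markov a)
            (fun p => p = x1 ^+ d1 - x2 ^+ d2 \/
               exists k, (k <= f3)%N /\
                 p = x3 ^+ d3 - x1 ^+ ((f3 - k) * d1) * x2 ^+ (k * d2))
        , same_set_up_to_sign (@universal_markov K 3 a) (critical a)
        , same_set_up_to_sign (@universal_markov K 3 a) (graver a)
        , same_set_up_to_sign (universal_groebner a)
            (fun p => [\/ p = x1 ^+ d1 - x2 ^+ d2,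
                          p = x1 ^+ (f3 * d1) - x3 ^+ d3
                        | p = x2 ^+ (f3 * d2) - x3 ^+ d3])
        & same_set_up_to_sign (@universal_groebner K 3 a) (circuits a)]].
Proof.
have formP := has_formP K HS Ha; split.
- rewrite (universally_freeP Ha); split=> [free|div].
    exact: (has_form_betti_divisible (free_has_form HS Ha free)).
  exact: (has_form_free (betti_divisible_has_form HS Ha div)).
- rewrite -formP; split; first exact: (betti_divisible_has_form HS Ha).
  exact: has_form_betti_divisible.
- move=> d1 d2 d3 f3 /(betti_form_has_form HS Ha)[i1 [i2 [i3 lab]]].
  by have [_ _ _ cop] := lab.
move=> d1 d2 d3 f3 i1 i2 i3 bf a1 a2 a3 x1 x2 x3.
have lab := betti_form_labelled HS Ha bf a1 a2 a3.
have sets (p : {mpoly K[3]}) := markov_sets lab p.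
have groeb (p : {mpoly K[3]}) := universal_groebner_circuit_list lab (g := p).
have list_groeb (p : {mpoly K[3]}) := circuit_list_universal_groebner lab (p := p).
have circ (p : {mpoly K[3]}) := circuit_listP lab (p := p).
have list_circ (p : {mpoly K[3]}) := circuit_list_circuit lab (p := p).
have sign (A B : {mpoly K[3]} -> Prop) : (forall p, A p -> B p \/ B (- p)) ->
    (forall p, B p -> A p \/ A (- p)) -> same_set_up_to_sign A B.
  by move=> AB BA p; split=> [[/AB|/AB]|[/BA|/BA]]; rewrite ?opprK; tauto.
split; apply: sign => q.
- by have [_ _ + +] := sets q; tauto.
- by have [+ + _ _] := sets q; rewrite /markov_list; tauto.
- by have [h h' k k'] := sets q; have [h1 h1' _ _] := sets (- q); tauto.
- by have [_ + _ _] := sets q; tauto.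
- by have [_ _ + _] := sets q; tauto.
- have [h h' _ k'] := sets q; have [h1 h1' _ _] := sets (- q); tauto.
- exact: groeb.
- exact: list_groeb.
- by move=> /groeb[/list_circ|/list_circ]; tauto.
by move=> /circ[/list_groeb|/list_groeb]; rewrite ?opprK; tauto.
Qed.
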